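(* Let $(\mathcal{T},\varphi)$ be a monoidal monad on a monoidal category $(\mathsf{C},\otimes,I)$. Assume that $\mathsf{C}$ admits reflexive coequalizers and that these are preserved by $\mathcal{T}$. There exists a normal colax monoidal structure $\underline{\otimes}^{\varphi}$ on $\mathsf{C}^{\mathcal{T}}$ with the following properties. (i) The forgetful functor $\mathcal{U}^{\mathcal{T}}:(\mathsf{C}^{\mathcal{T}},\underline{\otimes}^{\varphi})\to(\mathsf{C},\underline{\otimes})$ is monoidal and its structure maps are $(\mathcal{T},\varphi)$-multilinear. (ii) The associated multicategory is the multicategory of $(\mathcal{T},\varphi)$-multilinear maps: $\mathcal{M}(\mathsf{C}^{\mathcal{T}},\underline{\otimes}^{\varphi})\cong\mathsf{C}^{\mathcal{T},\varphi}$. (iii) The preceding isomorphism restricts to the canonical isomorphism $\mathcal{U}\mathcal{M}(\mathsf{C}^{\mathcal{T}},\underline{\otimes}^{\varphi})\cong\mathsf{C}^{\mathcal{T}}$ on the underlying categories.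
   Context: Monoidal categories are treated as if strict. A reflexive coequalizer is a coequalizer of a pair of maps with a common section. A monad $(\mathcal{T},\mu,\eta)$ on $(\mathsf{C},\otimes,I)$ is *monoidal* if $\mathcal{T}$ carries a lax monoidal structure $(\varphi,\varphi_0)$ for which $\mu,\eta$ are morphisms of monoidal functors; $\varphi$ also denotes the iterated maps $\mathcal{T}X_1\otimes\cdots\otimes\mathcal{T}X_n\to\mathcal{T}(X_1\otimes\cdots\otimes X_n)$ (identity for $n=1$, $\varphi_0$ for $n=0$). $\mathsf{C}^{\mathcal{T}}$ is the category of $\mathcal{T}$-algebras. For algebras $(V_i,v_i)$, $(W,w)$, a map $f:V_1\otimes\cdots\otimes V_n\to W$ in $\mathsf{C}$ is *$(\mathcal{T},\varphi)$-multilinear* if $w\circ\mathcal{T}f\circ\varphi=f\circ(v_1\otimes\cdots\otimes v_n)$. $\mathsf{C}^{\mathcal{T},\varphi}$ is the multicategory whose objects are $\mathcal{T}$-algebras and whose multimaps $(V_1,\dots,V_n)\to W$ are the multilinear maps $V_1\otimes\cdots\otimes V_n\to W$, composed by $g\circ(f_1\otimes\cdots\otimes f_n)$. For a multicategory $\mathsf{M}$, $\mathcal{U}(\mathsf{M})$ is its underlying category (objects and $1$-maps); $\mathcal{U}(\mathsf{C}^{\mathcal{T},\varphi})=\mathsf{C}^{\mathcal{T}}$. A *colax monoidal structure* $\underline{\star}$ on a category $\mathsf{D}$ consists of functors $\star^n:\mathsf{D}^n\to\mathsf{D}$ ($n\ge0$), a natural transformation $\epsilon:\star^1\to\mathrm{id}$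 and natural transformations $\alpha^{m_1,\dots,m_n}:\star^{m_1+\cdots+m_n}(\underline{X})\to\star^n(\star^{m_1}(\underline{X}^1),\dots,\star^{m_n}(\underline{X}^n))$, where $\underline{X}$ is the concatenation of the sequences $\underline{X}^i$ of length $m_i$, satisfying coassociativity (the two induced maps to any threefold nested tensor product agree) and counitality ($\epsilon\circ\alpha^{n}=\mathrm{id}$ and $\star^n(\epsilon,\dots,\epsilon)\circ\alpha^{1,\dots,1}=\mathrm{id}$). It is *normal* if $\epsilon$ is invertible. The monoidal category $(\mathsf{C},\otimes)$ is regarded as a normal colax monoidal category $(\mathsf{C},\underline{\otimes})$ with $\otimes^n(X_1,\dots,X_n)=X_1\otimes\cdots\otimes X_n$. A functor $U:(\mathsf{D},\underline{\star})\to(\mathsf{C},\underline{\otimes})$ between colax monoidal categories is *monoidal* if equipped with natural transformations $\gamma:\otimes^n(UV_1,\dots,UV_n)\to U(\star^n(V_1,\dots,V_n))$, $n\ge0$, with $U(\alpha)\circ\gamma=\gamma\circ\otimes^n(\gamma,\dots,\gamma)\circ\alpha$ and $U(\epsilon_V)\circ\gamma_V=\epsilon_{UV}$. A colax monoidal category $(\mathsf{D},\underline{\star})$ gives rise to a multicategory $\mathcal{M}(\mathsf{D},\underline{\star})$ with the same objects, whose multimaps $(X_1,\dots,X_n)\to Y$ are the morphisms $\star^n(X_1,\dots,X_n)\to Y$ in $\mathsf{D}$, with composition $g\circ\star^n(f_1,\dots,f_n)\circ\alpha$ and identities $\epsilon_X$. When normal, the canonical isomorphism $\mathsf{D}\cong\mathcal{U}\mathcal{M}(\mathsf{D},\underline{\star})$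 is the identity on objects and sends $f:X\to Y$ to $f\circ\epsilon_X$. *)

(* Defs.v *)
From Stdlib Require Import List ProofIrrelevance FunctionalExtensionality.
From Stdlib Require Import IndefiniteDescription.
From Stdlib Require Import Program.Equality ssreflect.
Import ListNotations.

Set Implicit Arguments.
Unset Strict Implicit.
Unset Printing Implicit Defensive.

Declare Scope cat_scope.
Delimit Scope cat_scope with cat.
Local Open Scope cat_scope.

(** * Categories and functors *)

Record Category := {
  ob :> Type;
  hom : ob -> ob -> Type;
  idm : forall X, hom X X;
  comp : forall X Y Z, hom Y Z -> hom X Y -> hom X Z;
  comp_idl : forall X Y (f : hom X Y), comp (idm Y) f = f;
  comp_idr : forall X Y (f : hom X Y), comp f (idm X) = f;
  compA : forall X Y Z W (h : hom Z W) (g : hom Y Z) (f : hom X Y),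
    comp h (comp g f) = comp (comp h g) f
}.
Arguments hom {_} _ _.
Arguments idm {_} _.

Notation "g ∘ f" := (comp g f) (at level 40, left associativity) : cat_scope.

Definition is_inverse (C : Category) (X Y : C) (f : hom X Y) (g : hom Y X) :=
  g ∘ f = idm X /\ f ∘ g = idm Y.

Definition is_iso (C : Category) (X Y : C) (f : hom X Y) :=
  exists g, is_inverse f g.

(* The identity of [X], seen as a morphism to an object equal to [X]. *)
Definition idto (C : Category) (X Y : C) (e : X = Y) : hom X Y :=
  eq_rect X (fun Z => hom X Z) (idm X) Y e.

Record Functor (C D : Category) := {
  fob :> C -> D;
  fmap : forall X Y, hom X Y -> hom (fob X) (fob Y);
  fmap_id : forall X, fmap (idm X) = idm (fob X);
  fmap_comp : forall X Y Z (g : hom Y Z) (f : hom X Y),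
    fmap (g ∘ f) = fmap g ∘ fmap f
}.
Arguments fmap {C D} _ {X Y} _.

Definition functor_id (C : Category) : Functor C C.
Proof. by refine (@Build_Functor C C (fun X => X) (fun _ _ f => f) _ _). Defined.

Definition functor_comp (C D E : Category) (G : Functor D E) (F : Functor C D) :
  Functor C E.
Proof.
refine (@Build_Functor C E (fun X => G (F X)) (fun _ _ f => fmap G (fmap F f)) _ _).
- by move=> X; rewrite !fmap_id.
- by move=> X Y Z g f; rewrite !fmap_comp.
Defined.

Lemma functor_eq (C D : Category) (o : C -> D)
    (m m' : forall X Y, hom X Y -> hom (o X) (o Y)) h1 h2 h1' h2' :
  (forall X Y f, m X Y f = m' X Y f) ->
  @Build_Functor C D o m h1 h2 = @Build_Functor C D o m' h1' h2'.
Proof.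
move=> E; have Em : m = m'.
  apply: functional_extensionality_dep => X.
  apply: functional_extensionality_dep => Y.
  exact: functional_extensionality_dep (E X Y).
by subst; f_equal; exact: proof_irrelevance.
Qed.

Definition is_iso_functor (C D : Category) (F : Functor C D) :=
  exists G : Functor D C,
    functor_comp G F = functor_id C /\ functor_comp F G = functor_id D.

(** * Families indexed by a pair of lists

   [fam R [a1; ..; an] [b1; ..; bn]] is [R a1 b1 * .. * R an bn]; it is empty
   when the lengths differ.  With [R := hom] it is the set of morphisms of the
   category [D^n]. *)

Inductive fam (A B : Type) (R : A -> B -> Type) : list A -> list B -> Type :=
| fnil : fam R [] []
| fcons a b l m : R a b -> fam R l m -> fam R (a :: l) (b :: m).
Arguments fnil {A B R}.
Arguments fcons {A B R a b l m} _ _.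

Fixpoint fam_diag A (R : A -> A -> Type) (t : forall a, R a a) (l : list A) :
    fam R l l :=
  match l with
  | [] => fnil
  | a :: l => fcons (t a) (fam_diag t l)
  end.

Fixpoint fam_tab A B B' (R : B -> B' -> Type) (f : A -> B) (g : A -> B')
    (t : forall a, R (f a) (g a)) (l : list A) : fam R (map f l) (map g l) :=
  match l with
  | [] => fnil
  | a :: l => fcons (t a) (fam_tab t l)
  end.

Fixpoint fam_map A A' B B' (R : A -> B -> Type) (R' : A' -> B' -> Type)
    (f : A -> A') (g : B -> B') (t : forall a b, R a b -> R' (f a) (g b))
    l m (fs : fam R l m) : fam R' (map f l) (map g m) :=
  match fs with
  | fnil => fnil
  | fcons r fs => fcons (t _ _ r) (fam_map t fs)
  end.

Fixpoint fam_mapl A A' B (R : A' -> B -> Type) (f : A -> A')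
    l m (fs : fam (fun a b => R (f a) b) l m) : fam R (map f l) m :=
  match fs with
  | fnil => fnil
  | fcons r fs => fcons r (fam_mapl fs)
  end.

Fixpoint fam_app A B (R : A -> B -> Type) l m (fs : fam R l m)
    l' m' (gs : fam R l' m') : fam R (l ++ l') (m ++ m') :=
  match fs with
  | fnil => gs
  | fcons r fs => fcons r (fam_app fs gs)
  end.

Fixpoint fam_concat A B (R : A -> B -> Type) ll mm (fss : fam (fam R) ll mm) :
    fam R (concat ll) (concat mm) :=
  match fss with
  | fnil => fnil
  | fcons fs fss => fam_app fs (fam_concat fss)
  end.

Fixpoint fam_zip A B E (R : A -> B -> Type) (S : B -> E -> Type)
    (Q : A -> E -> Type) (t : forall a b e, R a b -> S b e -> Q a e)
    l m k (fs : fam R l m) : fam S m k -> fam Q l k :=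
  match fs in fam _ l m return fam S m k -> fam Q l k with
  | fnil => fun gs =>
      match gs in fam _ m k
        return match m with [] => fam Q [] k | _ => unit end with
      | fnil => fnil
      | fcons _ _ => tt
      end
  | @fcons _ _ _ a b l m r fs => fun gs =>
      match gs in fam _ m0 k
        return match m0 with
               | [] => unit
               | b :: m => R a b -> (forall k, fam S m k -> fam Q l k) ->
                           fam Q (a :: l) k
               end with
      | fnil => tt
      | fcons s gs => fun r rec => fcons (t _ _ _ r s) (rec _ gs)
      end r (fun k => @fam_zip _ _ _ _ _ _ t l m k fs)
  end.

Section FamHom.
Variable D : Category.

Definition fam_id (Xs : list D) : fam hom Xs Xs := fam_diag (@idm D) Xs.

Definition fam_comp (Xs Ys Zs : list D) (gs : fam hom Ys Zs) (fs : fam hom Xs Ys) :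
    fam hom Xs Zs :=
  fam_zip (fun _ _ _ f g => g ∘ f) fs gs.

End FamHom.

Definition sing A (a : A) : list A := [a].

Lemma concat_concat A (l : list (list (list A))) :
  concat (concat l) = concat (map (@concat A) l).
Proof. by elim: l => //= a l IH; rewrite concat_app IH. Qed.

Lemma concat_sing A (l : list A) : concat (map (@sing A) l) = l.
Proof. by elim: l => //= a l ->. Qed.

(** * Colax monoidal structures *)

Record ColaxMonoidal (D : Category) := {
  star : list D -> D;
  star_map : forall Xs Ys : list D, fam hom Xs Ys -> hom (star Xs) (star Ys);
  star_id : forall Xs, star_map (fam_id Xs) = idm (star Xs);
  star_comp : forall Xs Ys Zs (gs : fam hom Ys Zs) (fs : fam hom Xs Ys),
    star_map (fam_comp gs fs) = star_map gs ∘ star_map fs;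
  eps : forall X : D, hom (star [X]) X;
  eps_nat : forall (X Y : D) (f : hom X Y),
    eps Y ∘ star_map (fcons f fnil) = f ∘ eps X;
  alpha : forall Xss : list (list D),
    hom (star (concat Xss)) (star (map star Xss));
  alpha_nat : forall Xss Yss (fss : fam (fam hom) Xss Yss),
    alpha Yss ∘ star_map (fam_concat fss) =
    star_map (fam_map star_map fss) ∘ alpha Xss;
  (* the two maps from [star (concat (concat Xsss))] to the threefold
     nested tensor product of [Xsss] *)
  coassoc : forall Xsss : list (list (list D)),
    alpha (map (map star) Xsss) ∘ idto (f_equal star (concat_map star Xsss))
      ∘ alpha (concat Xsss) =
    star_map (fam_map (f := star) (g := star) (fun _ _ f => f)
                (fam_tab (R := fun Xs Ys => hom (star Xs) (star Ys))
                   (f := @concat D) (g := map star) alpha Xsss))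
      ∘ alpha (map (@concat D) Xsss) ∘ idto (f_equal star (concat_concat Xsss));
  counit_l : forall Xs : list D,
    eps (star Xs) ∘ alpha [Xs] = idto (f_equal star (app_nil_r Xs));
  counit_r : forall Xs : list D,
    star_map (fam_mapl (f := star) (fam_mapl (f := @sing D) (fam_diag eps Xs)))
      ∘ alpha (map (@sing D) Xs) = idto (f_equal star (concat_sing Xs))
}.
Arguments star {D} _ _.
Arguments star_map {D} _ {Xs Ys} _.
Arguments eps {D} _ _.
Arguments alpha {D} _ _.

Definition normal (D : Category) (S : ColaxMonoidal D) :=
  forall X : D, is_iso (eps S X).

(* The family of maps [gamma : ⊗(U V_1^i, U V_2^i, ..) -> U (⋆(V_1^i, ..))]. *)
Record ColaxMonoidalFunctor (D C : Category) (S : ColaxMonoidal D)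
    (S' : ColaxMonoidal C) (U : Functor D C) := {
  gamma : forall Vs : list D, hom (star S' (map U Vs)) (U (star S Vs));
  gamma_nat : forall Vs Ws (fs : fam hom Vs Ws),
    gamma Ws ∘ star_map S' (fam_map (@fmap _ _ U) fs) =
    fmap U (star_map S fs) ∘ gamma Vs;
  gamma_alpha : forall Vss : list (list D),
    fmap U (alpha S Vss) ∘ gamma (concat Vss) =
    gamma (map (star S) Vss)
      ∘ star_map S' (fam_map (f := star S') (g := U) (fun _ _ f => f)
                       (fam_tab (R := fun Xs V => hom (star S' Xs) (U V))
                          (f := map U) (g := star S) gamma Vss))
      ∘ alpha S' (map (map U) Vss)
      ∘ idto (f_equal (star S') (concat_map U Vss));
  gamma_eps : forall V : D,
    fmap U (eps S V) ∘ gamma [V] = eps S' (U V)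
}.
Arguments gamma {D C S S' U} _ _.

(** * Multicategories *)

Definition hcast (O : Type) (H : list O -> O -> Type) (Xs Ys : list O)
    (e : Xs = Ys) (Z : O) (f : H Xs Z) : H Ys Z :=
  eq_rect Xs (fun l => H l Z) f Ys e.

Record Multicategory := {
  mob :> Type;
  mhom : list mob -> mob -> Type;
  mid : forall X, mhom [X] X;
  mcomp : forall Xss Ys Z,
    mhom Ys Z -> fam mhom Xss Ys -> mhom (concat Xss) Z;
  mcomp_idl : forall Xs Y (f : mhom Xs Y),
    hcast (app_nil_r Xs) (mcomp (mid Y) (fcons f fnil)) = f;
  mcomp_idr : forall Xs Y (f : mhom Xs Y),
    hcast (concat_sing Xs)
      (mcomp f (fam_mapl (f := @sing mob) (fam_diag mid Xs))) = f;
  mcompA : forall Xsss Yss Zs W (h : mhom Zs W) (gs : fam mhom Yss Zs)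
      (fss : fam (fam mhom) Xsss Yss),
    hcast (concat_concat Xsss) (mcomp (mcomp h gs) (fam_concat fss)) =
    mcomp h (fam_mapl (f := @concat mob)
               (fam_zip (fun _ _ _ fs g => mcomp g fs) fss gs))
}.
Arguments mhom {_} _ _.
Arguments mid {_} _.

Record Multifunctor (M N : Multicategory) := {
  mfob :> M -> N;
  mfmap : forall Xs Y, mhom Xs Y -> mhom (map mfob Xs) (mfob Y);
  mfmap_id : forall X, mfmap (mid X) = mid (mfob X);
  mfmap_comp : forall Xss Ys Z (g : mhom Ys Z) (fs : fam mhom Xss Ys),
    hcast (concat_map mfob Xss) (mfmap (mcomp g fs)) =
    mcomp (mfmap g) (fam_map mfmap fs)
}.
Arguments mfmap {M N} _ {Xs Y} _.

(** * Casts along equalities of lists *)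

Lemma idto_refl (C : Category) (X : C) (e : X = X) : idto e = idm X.
Proof. by rewrite (proof_irrelevance _ e eq_refl). Qed.

Lemma idto_comp (C : Category) (X Y Z : C) (e : X = Y) (e' : Y = Z) :
  idto e' ∘ idto e = idto (eq_trans e e').
Proof. by subst; exact: comp_idl. Qed.

Lemma idto_irr (C : Category) (X Y : C) (e e' : X = Y) : idto e = idto e'.
Proof. by rewrite (proof_irrelevance _ e e'). Qed.

Lemma hcast_refl (O : Type) (H : list O -> O -> Type) Xs (e : Xs = Xs) Z
  (f : H Xs Z) : hcast e f = f.
Proof. by rewrite (proof_irrelevance _ e eq_refl). Qed.

Lemma hcast_comp (O : Type) (H : list O -> O -> Type) Xs Ys Zs (e : Xs = Ys)
  (e' : Ys = Zs) W (f : H Xs W) : hcast e' (hcast e f) = hcast (eq_trans e e') f.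
Proof. by subst. Qed.

Lemma hcast_irr (O : Type) (H : list O -> O -> Type) Xs Ys (e e' : Xs = Ys) W
  (f : H Xs W) : hcast e f = hcast e' f.
Proof. by rewrite (proof_irrelevance _ e e'). Qed.

Definition fcast A B (R : A -> B -> Type) l l' m m' (e : l = l') (e' : m = m')
    (fs : fam R l m) : fam R l' m' :=
  eq_rect l (fun l => fam R l m') (eq_rect m (fun m => fam R l m) fs m' e') l' e.

Lemma fcast_refl A B (R : A -> B -> Type) l m (e : l = l) (e' : m = m)
  (fs : fam R l m) : fcast e e' fs = fs.
Proof.
by rewrite (proof_irrelevance _ e eq_refl) (proof_irrelevance _ e' eq_refl).
Qed.

Lemma fcast_nil A B (R : A -> B -> Type) e e' :
  fcast e e' fnil = fnil :> fam R [] [].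
Proof. exact: fcast_refl. Qed.

Lemma fcast_cons A B (R : A -> B -> Type) a a' b b' l l' m m'
    (ea : a = a') (eb : b = b') (el : l = l') (em : m = m')
    (e : a :: l = a' :: l') (e' : b :: m = b' :: m')
    (r : R a b) (fs : fam R l m) :
  fcast e e' (fcons r fs) =
  fcons (eq_rect a (fun a => R a b') (eq_rect b (fun b => R a b) r b' eb) a' ea)
        (fcast el em fs).
Proof. by subst; rewrite fcast_refl. Qed.

Lemma fcast_comp A B (R : A -> B -> Type) l l' l'' m m' m'' (e1 : l = l')
    (e1' : l' = l'') (e2 : m = m') (e2' : m' = m'') (fs : fam R l m) :
  fcast e1' e2' (fcast e1 e2 fs) = fcast (eq_trans e1 e1') (eq_trans e2 e2') fs.
Proof. by subst. Qed.

Lemma fcast_irr A B (R : A -> B -> Type) l l' m m' (e1 e1' : l = l')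
    (e2 e2' : m = m') (fs : fam R l m) : fcast e1 e2 fs = fcast e1' e2' fs.
Proof. by rewrite (proof_irrelevance _ e1 e1') (proof_irrelevance _ e2 e2'). Qed.

Lemma fam_app_fcast A B (R : A -> B -> Type) l m l1 l2 m1 m2 (e1 : l1 = l2)
    (e2 : m1 = m2) (fs : fam R l m) (gs : fam R l1 m1) e e' :
  fam_app fs (fcast e1 e2 gs) = fcast e e' (fam_app fs gs).
Proof. by subst; rewrite /= fcast_refl. Qed.

Lemma fam_mapl_app A A' B (R : A' -> B -> Type) (f : A -> A') l m l' m'
    (fs : fam (fun a b => R (f a) b) l m) (gs : fam (fun a b => R (f a) b) l' m') e :
  fcast e eq_refl (fam_mapl (fam_app fs gs)) = fam_app (fam_mapl fs) (fam_mapl gs).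
Proof.
elim: fs e => [|a b {}l {}m r fs IH] e /=; first by rewrite fcast_refl.
have el : map f (l ++ l') = map f l ++ map f l' by case: e.
by rewrite (fcast_cons eq_refl eq_refl el eq_refl) /= IH.
Qed.

Lemma fam_map_app A A' B B' (R : A -> B -> Type) (R' : A' -> B' -> Type)
    (f : A -> A') (g : B -> B') (t : forall a b, R a b -> R' (f a) (g b))
    l m (fs : fam R l m) l' m' (gs : fam R l' m') e e' :
  fam_map t (fam_app fs gs) = fcast e e' (fam_app (fam_map t fs) (fam_map t gs)).
Proof.
elim: fs e e' => [|a b {}l {}m r fs IH] e e' /=; first by rewrite fcast_refl.
have el : map f l ++ map f l' = map f (l ++ l') by case: e.
have em : map g m ++ map g m' = map g (m ++ m') by case: e'.
by rewrite (fcast_cons eq_refl eq_refl el em) -IH.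
Qed.

Lemma fam_map_concat A A' B B' (R : A -> B -> Type) (R' : A' -> B' -> Type)
    (f : A -> A') (g : B -> B') (t : forall a b, R a b -> R' (f a) (g b))
    ll mm (fss : fam (fam R) ll mm) e e' :
  fam_map t (fam_concat fss) =
  fcast e e' (fam_concat (fam_map (f := map f) (g := map g)
                            (fun _ _ => @fam_map _ _ _ _ _ _ _ _ t _ _) fss)).
Proof.
elim: fss e e' => [|l m {}ll {}mm fs fss IH] e e' /=; first by rewrite fcast_refl.
have a := eq_sym (map_app f l (concat ll)).
have b := eq_sym (map_app g m (concat mm)).
rewrite (fam_map_app _ _ _ a b).
rewrite (IH (eq_sym (concat_map f ll)) (eq_sym (concat_map g mm))).
have e1 : map f l ++ concat (map (map f) ll) = map f l ++ map f (concat ll).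
  by rewrite concat_map.
have e2 : map g m ++ concat (map (map g) mm) = map g m ++ map g (concat mm).
  by rewrite concat_map.
rewrite (fam_app_fcast _ _ _ _ e1 e2) fcast_comp; exact: fcast_irr.
Qed.

Lemma mcomp_fcast (M : Multicategory) (Xss Xss' : list (list M)) (Ys Ys' : list M) Z
    (e : Xss = Xss') (e' : Ys = Ys') (g : mhom Ys Z) (fs : fam mhom Xss Ys) :
  mcomp (hcast e' g) (fcast e e' fs) = hcast (f_equal (@concat M) e) (mcomp g fs).
Proof. by subst. Qed.

(** * Composition and isomorphisms of multifunctors *)

Lemma multifunctor_id_map (M : Multicategory) Xss (Ys : list M)
    (fs : fam mhom Xss Ys) e :
  fam_map (f := map (fun X : M => X)) (g := fun X => X) (R' := mhom)
     (fun Xs Y f => hcast (eq_sym (map_id Xs)) f) fs =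
  fcast e (eq_sym (map_id Ys)) fs.
Proof.
elim: fs e => [|Xs Y l m f fs IH] e /=; first by rewrite fcast_nil.
have el : l = map (map (fun X => X)) l by case: e.
rewrite (fcast_cons (eq_sym (map_id Xs)) (eq_refl Y) el (eq_sym (map_id m))).
by rewrite -IH.
Qed.

Definition multifunctor_id (M : Multicategory) : Multifunctor M M.
Proof.
refine (@Build_Multifunctor M M (fun X => X)
          (fun Xs Y f => hcast (eq_sym (map_id Xs)) f) _ _).
- by move=> X; rewrite hcast_refl.
- move=> Xss Ys Z g fs.
  have e : Xss = map (map (fun X => X)) Xss.
    by rewrite -[LHS]map_id; apply: map_ext => Xs; rewrite map_id.
  rewrite (multifunctor_id_map _ e) mcomp_fcast hcast_comp; exact: hcast_irr.
Defined.

Lemma multifunctor_comp_map (M N P : Multicategory) (G : Multifunctor N P)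
    (F : Multifunctor M N) Xss (Ys : list M) (fs : fam mhom Xss Ys) e :
  fam_map (f := map (fun X => G (F X))) (g := fun X => G (F X)) (R' := mhom)
    (fun Xs Y f => hcast (map_map F G Xs) (mfmap G (mfmap F f))) fs =
  fcast e (map_map F G Ys)
    (fam_map (@mfmap _ _ G) (fam_map (@mfmap _ _ F) fs)).
Proof.
elim: fs e => [|Xs Y l m f fs IH] e /=; first by rewrite fcast_nil.
have el : map (map G) (map (map F) l) = map (map (fun X => G (F X))) l by case: e.
rewrite (fcast_cons (map_map F G Xs) (eq_refl (G (F Y))) el (map_map F G m)).
by rewrite -IH.
Qed.

Lemma mfmap_hcast (M N : Multicategory) (F : Multifunctor M N) Xs Ys
    (e : Xs = Ys) Z (f : mhom Xs Z) :
  mfmap F (hcast e f) = hcast (f_equal (map F) e) (mfmap F f).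
Proof. by subst. Qed.

Definition multifunctor_comp (M N P : Multicategory) (G : Multifunctor N P)
  (F : Multifunctor M N) : Multifunctor M P.
Proof.
refine (@Build_Multifunctor M P (fun X => G (F X))
          (fun Xs Y f => hcast (map_map F G Xs) (mfmap G (mfmap F f))) _ _).
- by move=> X; rewrite !mfmap_id hcast_refl.
- move=> Xss Ys Z g fs.
  have e : map (map G) (map (map F) Xss) = map (map (fun X => G (F X))) Xss.
    by rewrite map_map; apply: map_ext => Xs; rewrite map_map.
  rewrite (multifunctor_comp_map _ e) mcomp_fcast.
  rewrite -(mfmap_comp G) -(mfmap_comp F) mfmap_hcast !hcast_comp.
  exact: hcast_irr.
Defined.

Definition is_iso_multifunctor (M N : Multicategory) (F : Multifunctor M N) :=
  exists G : Multifunctor N M,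
    multifunctor_comp G F = multifunctor_id M /\
    multifunctor_comp F G = multifunctor_id N.

(** * The underlying category of a multicategory *)

Definition underlying (M : Multicategory) : Category.
Proof.
refine (@Build_Category M (fun X Y => mhom [X] Y) (fun X => mid X)
   (fun X Y Z g f => mcomp g (fcons (R := mhom) (a := [X]) f fnil)) _ _ _).
- by move=> X Y f; rewrite -[RHS]mcomp_idl hcast_refl.
- by move=> X Y f; rewrite -[RHS]mcomp_idr hcast_refl.
- move=> X Y Z W h g f.
  have := mcompA h (fcons (R := mhom) (a := [Y]) g fnil)
    (fcons (R := fam mhom) (fcons (R := mhom) (a := [X]) f fnil) fnil).
  by rewrite hcast_refl.
Defined.

Definition underlying_functor (M N : Multicategory) (F : Multifunctor M N) :
  Functor (underlying M) (underlying N).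
Proof.
refine (@Build_Functor (underlying M) (underlying N) F
  (fun X Y f => mfmap F (f : mhom [X] Y)) _ _).
- by move=> X; exact: mfmap_id.
- move=> X Y Z g f.
  have := mfmap_comp F (g : mhom [Y] Z) (fcons (R := mhom) (a := [X]) f fnil).
  by rewrite hcast_refl.
Defined.

(** * The multicategory of a colax monoidal category *)

Section MulticatOfColax.
Variables (D : Category) (S : ColaxMonoidal D).

Definition star_hom (Xs : list D) (Y : D) := hom (star S Xs) Y.

Definition star_compose (Xss : list (list D)) (Ys : list D) (Z : D)
    (g : star_hom Ys Z) (fs : fam star_hom Xss Ys) : star_hom (concat Xss) Z :=
  g ∘ star_map S (fam_mapl (R := hom) (f := star S) fs) ∘ alpha S Xss.

Lemma star_hcast Xs Ys (e : Xs = Ys) Z (f : star_hom Xs Z) :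
  hcast e f = (f : hom _ _) ∘ idto (f_equal (star S) (eq_sym e)).
Proof. by subst; rewrite /= comp_idr. Qed.

Lemma star_compose_idl Xs Y (f : star_hom Xs Y) :
  hcast (app_nil_r Xs) (star_compose (eps S Y) (fcons f fnil)) = f.
Proof.
rewrite star_hcast /star_compose /= (eps_nat S (f : hom _ _)) -(compA f).
by rewrite (counit_l S) -compA idto_comp idto_refl comp_idr.
Qed.

Lemma star_compose_idr Xs Y (f : star_hom Xs Y) :
  hcast (concat_sing Xs)
    (star_compose f (fam_mapl (f := @sing D) (fam_diag (eps S) Xs))) = f.
Proof.
rewrite star_hcast /star_compose -(compA f) (counit_r S) -compA idto_comp.
by rewrite idto_refl comp_idr.
Qed.

Fixpoint star_homss Xsss Yss (fss : fam (fam star_hom) Xsss Yss) :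
    fam (fam hom) (map (map (star S)) Xsss) Yss :=
  match fss with
  | fnil => fnil
  | fcons fs fss => fcons (fam_mapl (R := hom) (f := star S) fs) (star_homss fss)
  end.

Lemma star_homs_concat Xsss Yss (fss : fam (fam star_hom) Xsss Yss) :
  fcast (concat_map (star S) Xsss) eq_refl
    (fam_mapl (R := hom) (f := star S) (fam_concat fss)) =
  fam_concat (star_homss fss).
Proof.
move: (concat_map _ _); elim: fss => [|Xss Ys Xsss' Yss' fs fss IH] e /=.
  by rewrite fcast_refl.
rewrite -(IH (concat_map _ _)).
have e' : map (star S) Xss ++ map (star S) (concat Xsss') = 
         map (star S) Xss ++ concat (map (map (star S)) Xsss').
  by rewrite concat_map.
rewrite (fam_app_fcast _ _ _ _ e' eq_refl).
rewrite -(fam_mapl_app (R := hom) fs (fam_concat fss) (map_app _ _ _)) fcast_comp.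
exact: fcast_irr.
Qed.

Lemma star_map_fcast Xs Xs' Ys (e : Xs = Xs') (fs : fam hom Xs Ys) :
  star_map S (fcast e eq_refl fs) = 
  star_map S fs ∘ idto (f_equal (star S) (eq_sym e)).
Proof. by subst; rewrite /= comp_idr. Qed.

Lemma star_homss_zip Xsss Yss Zs (fss : fam (fam star_hom) Xsss Yss)
    (gs : fam star_hom Yss Zs) :
  fam_mapl (R := hom) (f := star S) (fam_mapl (f := @concat D)
     (fam_zip (fun _ _ _ fs g => star_compose g fs) fss gs)) =
  fam_comp (fam_comp (fam_mapl (R := hom) (f := star S) gs)
              (fam_map (@star_map _ S) (star_homss fss)))
    (fam_map (f := star S) (g := star S) (fun _ _ f => f)
       (fam_tab (R := fun Xs Ys => hom (star S Xs) (star S Ys))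
           (f := @concat D) (g := map (star S)) (alpha S) Xsss)).
Proof.
elim: fss Zs gs => [|Xss Ys Xsss' Yss' fs fss IH] Zs gs; dependent destruction gs => //=.
rewrite IH //.
Qed.

Lemma star_composeA Xsss Yss Zs W (h : star_hom Zs W) (gs : fam star_hom Yss Zs)
    (fss : fam (fam star_hom) Xsss Yss) :
  hcast (concat_concat Xsss) (star_compose (star_compose h gs) (fam_concat fss)) =
  star_compose h (fam_mapl (f := @concat D)
     (fam_zip (fun _ _ _ fs g => star_compose g fs) fss gs)).
Proof.
rewrite star_hcast [in RHS]/star_compose star_homss_zip !star_comp.
have E : star_map S (fam_mapl (R := hom) (f := star S) (fam_concat fss)) =
  star_map S (fam_concat (star_homss fss))
   ∘ idto (f_equal (star S) (concat_map (star S) Xsss)).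
  rewrite -star_homs_concat star_map_fcast -compA idto_comp idto_refl.
  by rewrite comp_idr.
rewrite /star_compose E !compA -(compA _ (alpha S Yss)) alpha_nat !compA.
have H := coassoc S Xsss.
rewrite -(compA _ _ (idto (f_equal _ (concat_map _ _)))).
rewrite -(compA _ _ (alpha S (concat Xsss))) H !compA.
rewrite -!compA idto_comp idto_refl comp_idr //.
Qed.

Definition multicat_of_colax : Multicategory :=
  @Build_Multicategory D star_hom (eps S) star_compose star_compose_idl
    star_compose_idr star_composeA.

Definition canonical_functor : Functor D (underlying multicat_of_colax).
Proof.
refine (@Build_Functor D (underlying multicat_of_colax) (fun X => X)
          (fun X Y f => f ∘ eps S X) _ _).
- by move=> X /=; rewrite comp_idl.
- move=> X Y Z g f /=; rewrite /star_compose /=.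
  rewrite -!compA; congr (_ ∘ _); rewrite !compA eps_nat -!compA (counit_l S [X]).
  by rewrite idto_refl comp_idr.
Defined.

Lemma canonical_functor_iso : normal S -> is_iso_functor canonical_functor.
Proof.
move=> nS; pose inv X := constructive_indefinite_description _ (nS X).
have H1 X : eps S X ∘ proj1_sig (inv X) = idm X by case: (inv X) => g [].
have H2 X : proj1_sig (inv X) ∘ eps S X = idm _ by case: (inv X) => g [].
pose m (X Y : D) (f : star_hom [X] Y) : hom X Y := f ∘ proj1_sig (inv X).
have Hid (X : D) : m X X (eps S X) = idm X by exact: H1.
have Hcomp (X Y Z : D) (g : star_hom [Y] Z) (f : star_hom [X] Y) :
    m X Z (star_compose g (fcons (R := star_hom) (a := [X]) f fnil)) =
    m Y Z g ∘ m X Y f.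
  rewrite /m /star_compose /=.
  have E : star_map S (fcons (R := hom) (a := star S [X]) f fnil) ∘ alpha S [[X]] =
           proj1_sig (inv Y) ∘ f.
    rewrite -[LHS]comp_idl -H2 -!compA (compA (eps S Y)) eps_nat -compA.
    by rewrite (counit_l S [X]) idto_refl comp_idr.
  by rewrite -(compA g) E !compA.
exists (@Build_Functor (underlying multicat_of_colax) D (fun X => X) m Hid Hcomp).
split; apply: functor_eq => X Y f; rewrite /m /=.
- by rewrite -compA H1 comp_idr.
- by rewrite -compA H2 comp_idr.
Qed.

End MulticatOfColax.

(** * Monoidal categories *)

Record MonoidalCategory := {
  mcat :> Category;
  tensor : mcat -> mcat -> mcat;
  tensor_map : forall X X' Y Y', hom X X' -> hom Y Y' ->
    hom (tensor X Y) (tensor X' Y');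
  tensor_map_id : forall X Y,
    tensor_map (idm X) (idm Y) = idm (tensor X Y);
  tensor_map_comp : forall X X' X'' Y Y' Y'' (f' : hom X' X'') (f : hom X X')
      (g' : hom Y' Y'') (g : hom Y Y'),
    tensor_map (f' ∘ f) (g' ∘ g) = tensor_map f' g' ∘ tensor_map f g;
  unit_ob : mcat;
  assoc : forall X Y Z, hom (tensor (tensor X Y) Z) (tensor X (tensor Y Z));
  assoc_inv : forall X Y Z, hom (tensor X (tensor Y Z)) (tensor (tensor X Y) Z);
  assocK : forall X Y Z, is_inverse (assoc X Y Z) (assoc_inv X Y Z);
  assoc_nat : forall X X' Y Y' Z Z' (f : hom X X') (g : hom Y Y') (h : hom Z Z'),
    assoc X' Y' Z' ∘ tensor_map (tensor_map f g) h =
    tensor_map f (tensor_map g h) ∘ assoc X Y Z;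
  lunit : forall X, hom (tensor unit_ob X) X;
  lunit_inv : forall X, hom X (tensor unit_ob X);
  lunitK : forall X, is_inverse (lunit X) (lunit_inv X);
  lunit_nat : forall X Y (f : hom X Y),
    lunit Y ∘ tensor_map (idm unit_ob) f = f ∘ lunit X;
  runit : forall X, hom (tensor X unit_ob) X;
  runit_inv : forall X, hom X (tensor X unit_ob);
  runitK : forall X, is_inverse (runit X) (runit_inv X);
  runit_nat : forall X Y (f : hom X Y),
    runit Y ∘ tensor_map f (idm unit_ob) = f ∘ runit X;
  triangle : forall X Y,
    tensor_map (idm X) (lunit Y) ∘ assoc X unit_ob Y = tensor_map (runit X) (idm Y);
  pentagon : forall X Y Z W,
    assoc X Y (tensor Z W) ∘ assoc (tensor X Y) Z W =
    tensor_map (idm X) (assoc Y Z W) ∘ assoc X (tensor Y Z) W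
      ∘ tensor_map (assoc X Y Z) (idm W)
}.
Arguments tensor {_} _ _.
Arguments tensor_map {_ X X' Y Y'} _ _.
Arguments unit_ob {_}.
Arguments assoc {_} _ _ _.
Arguments assoc_inv {_} _ _ _.
Arguments lunit {_} _.
Arguments lunit_inv {_} _.
Arguments runit {_} _.
Arguments runit_inv {_} _.

Notation "X ⊗ Y" := (tensor X Y) (at level 36, left associativity) : cat_scope.
Notation "f ⊠ g" := (tensor_map f g) (at level 36, left associativity) : cat_scope.

Lemma inverse_epi (C : Category) (X Y : C) (f : hom X Y) (f' : hom Y X) :
  is_inverse f f' -> forall Z (g h : hom Y Z), g ∘ f = h ∘ f -> g = h.
Proof. by case=> _ E Z g h H; rewrite -[g]comp_idr -[h]comp_idr -E !compA H. Qed.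

Lemma inverse_mono (C : Category) (X Y : C) (f : hom X Y) (f' : hom Y X) :
  is_inverse f f' -> forall Z (g h : hom Z X), f ∘ g = f ∘ h -> g = h.
Proof. by case=> E _ Z g h H; rewrite -[g]comp_idl -[h]comp_idl -E -!compA H. Qed.

Lemma inverse_sym (C : Category) (X Y : C) (f : hom X Y) (f' : hom Y X) :
  is_inverse f f' -> is_inverse f' f.
Proof. by case. Qed.

Section Coherence.
Variable C : MonoidalCategory.
Implicit Types X Y Z W : C.

Lemma tensor_inverse X X' Y Y' (f : hom X X') f' (g : hom Y Y') g' :
  is_inverse f f' -> is_inverse g g' -> is_inverse (f ⊠ g) (f' ⊠ g').
Proof.
by case=> a b [c d]; split; rewrite -tensor_map_comp ?a ?b ?c ?d tensor_map_id.
Qed.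

Lemma id_inverse X : is_inverse (idm X) (idm X).
Proof. by split; rewrite comp_idl. Qed.

Lemma tensor_map_compr X Y Y' Y'' (g' : hom Y' Y'') (g : hom Y Y') :
  idm X ⊠ (g' ∘ g) = idm X ⊠ g' ∘ (idm X ⊠ g).
Proof. by rewrite -tensor_map_comp comp_idl. Qed.

Lemma tensor_map_compl X X' X'' Y (f' : hom X' X'') (f : hom X X') :
  (f' ∘ f) ⊠ idm Y = f' ⊠ idm Y ∘ (f ⊠ idm Y).
Proof. by rewrite -tensor_map_comp comp_idl. Qed.

Lemma tensor_id_l_inj X Y (f g : hom X Y) :
  idm unit_ob ⊠ f = idm unit_ob ⊠ g -> f = g.
Proof. by move=> E; apply: (inverse_epi (lunitK X)); rewrite -!lunit_nat E. Qed.

Lemma tensor_id_r_inj X Y (f g : hom X Y) :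
  f ⊠ idm unit_ob = g ⊠ idm unit_ob -> f = g.
Proof. by move=> E; apply: (inverse_epi (runitK X)); rewrite -!runit_nat E. Qed.

Lemma pentagon_comp X Y Z W V (h : hom (X ⊗ (Y ⊗ (Z ⊗ W))) V) :
  h ∘ (idm X ⊠ assoc Y Z W) ∘ assoc X (Y ⊗ Z) W ∘ (assoc X Y Z ⊠ idm W) =
  h ∘ assoc X Y (Z ⊗ W) ∘ assoc (X ⊗ Y) Z W.
Proof. by rewrite -!compA (compA _ (assoc X _ W)) -pentagon. Qed.

Lemma lunit_tensor X Y : lunit (X ⊗ Y) ∘ assoc unit_ob X Y = lunit X ⊠ idm Y.
Proof.
apply: tensor_id_l_inj.
have I := tensor_inverse (assocK unit_ob unit_ob X) (id_inverse Y).
apply: (inverse_epi (assocK _ _ _)); apply: (inverse_epi I).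
rewrite tensor_map_compr pentagon_comp triangle.
rewrite -[idm (X ⊗ Y)]tensor_map_id -!assoc_nat -triangle -!compA.
by rewrite -tensor_map_comp comp_idl.
Qed.

Lemma runit_tensor X Y : idm X ⊠ runit Y ∘ assoc X Y unit_ob = runit (X ⊗ Y).
Proof.
apply: tensor_id_r_inj; apply: (inverse_mono (assocK _ _ _)).
rewrite tensor_map_compl compA assoc_nat -triangle.
rewrite -[in RHS]triangle -tensor_map_id tensor_map_compr pentagon_comp.
by rewrite [in RHS]compA assoc_nat.
Qed.

Lemma lunit_runit : lunit unit_ob = runit unit_ob :> hom (unit_ob ⊗ unit_ob : C) _.
Proof.
apply: tensor_id_r_inj; rewrite -triangle -lunit_tensor; congr (_ ∘ _).
by apply: (inverse_mono (lunitK unit_ob)); rewrite lunit_nat.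
Qed.
End Coherence.

(** * Iterated tensor products

   [tens [X1; ..; Xn]] is [X1 ⊗ (X2 ⊗ (.. ⊗ Xn))]; it is [X] (and not [X ⊗ I])
   on the singleton [[X]], and [I] on the empty list. *)

Fixpoint tens (C : MonoidalCategory) (Xs : list C) : C :=
  match Xs with
  | [] => unit_ob
  | X :: Xs' => match Xs' with [] => X | _ :: _ => X ⊗ tens Xs' end
  end.

Fixpoint tens_map (C : MonoidalCategory) (Xs Ys : list C) (fs : fam hom Xs Ys) :
    hom (tens Xs) (tens Ys) :=
  match fs in fam _ Xs Ys return hom (tens Xs) (tens Ys) with
  | fnil => idm unit_ob
  | @fcons _ _ _ X Y Xs' Ys' f fs' =>
      match fs' in fam _ Xs' Ys'
        return hom (tens Xs') (tens Ys') -> hom (tens (X :: Xs')) (tens (Y :: Ys'))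
      with
      | fnil => fun _ => f
      | fcons _ _ => fun g => f ⊠ g
      end (tens_map fs')
  end.

Definition tcons (C : MonoidalCategory) (X : C) (Xs : list C) :
    hom (tens (X :: Xs)) (X ⊗ tens Xs) :=
  match Xs return hom (tens (X :: Xs)) (X ⊗ tens Xs) with
  | [] => runit_inv X
  | X' :: Xs' => idm (X ⊗ tens (X' :: Xs'))
  end.

Definition tcons_inv (C : MonoidalCategory) (X : C) (Xs : list C) :
    hom (X ⊗ tens Xs) (tens (X :: Xs)) :=
  match Xs return hom (X ⊗ tens Xs) (tens (X :: Xs)) with
  | [] => runit X
  | X' :: Xs' => idm (X ⊗ tens (X' :: Xs'))
  end.

Fixpoint tsplit (C : MonoidalCategory) (Xs Ys : list C) :
    hom (tens (Xs ++ Ys)) (tens Xs ⊗ tens Ys) :=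
  match Xs return hom (tens (Xs ++ Ys)) (tens Xs ⊗ tens Ys) with
  | [] => lunit_inv (tens Ys)
  | X :: Xs => tcons_inv X Xs ⊠ idm (tens Ys) ∘ assoc_inv X (tens Xs) (tens Ys)
                 ∘ (idm X ⊠ tsplit Xs Ys) ∘ tcons X (Xs ++ Ys)
  end.

(* The coherence isomorphism rebracketing a tensor product into blocks; it is
   an identity when [C] is strict. *)
Fixpoint tens_alpha (C : MonoidalCategory) (Xss : list (list C)) :
    hom (tens (concat Xss)) (tens (map (@tens C) Xss)) :=
  match Xss return hom (tens (concat Xss)) (tens (map (@tens C) Xss)) with
  | [] => idm unit_ob
  | Xs :: Xss => tcons_inv (tens Xs) (map (@tens C) Xss)
                   ∘ (idm (tens Xs) ⊠ tens_alpha Xss) ∘ tsplit Xs (concat Xss)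
  end.

Arguments tens : simpl never.
Arguments tens_map : simpl never.
Arguments tcons : simpl never.
Arguments tcons_inv : simpl never.
Arguments tsplit : simpl never.
Arguments tens_alpha : simpl never.

Section Reassociation.
Variable C : Category.
Variables X Y Z W : C.

Lemma re2 (g : hom Y Z) (f : hom X Y) k : g ∘ f = k ->
  forall V (h : hom Z V), h ∘ g ∘ f = h ∘ k.
Proof. by move=> E V h; rewrite -compA E. Qed.

Lemma re3 (g' : hom Z W) (g : hom Y Z) (f : hom X Y) k : g' ∘ g ∘ f = k ->
  forall V (h : hom W V), h ∘ g' ∘ g ∘ f = h ∘ k.
Proof. by move=> E V h; rewrite -!compA (compA g') E. Qed.
End Reassociation.

Section Tens.
Variable C : MonoidalCategory.
Implicit Types X Y Z : C.
Implicit Types Xs Ys Zs : list C.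

Lemma tconsK X Xs : is_inverse (tcons X Xs) (tcons_inv X Xs).
Proof.
by case: Xs => [|Y Ys]; [exact: inverse_sym (runitK X) | exact: id_inverse].
Qed.

Lemma tens_map_cons X Y Xs Ys (f : hom X Y) (fs : fam hom Xs Ys) :
  tens_map (fcons f fs) = tcons_inv Y Ys ∘ (f ⊠ tens_map fs) ∘ tcons X Xs.
Proof.
case: fs => [|X' Y' Xs' Ys' f' fs] /=; last by rewrite comp_idl comp_idr.
by rewrite runit_nat -compA (proj2 (runitK X)) comp_idr.
Qed.

Lemma tens_map_consr X Y Xs Ys (f : hom X Y) (fs : fam hom Xs Ys) :
  tcons Y Ys ∘ tens_map (fcons f fs) = f ⊠ tens_map fs ∘ tcons X Xs.
Proof. by rewrite tens_map_cons !compA (proj2 (tconsK _ _)) comp_idl. Qed.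

Lemma tens_map_consl X Y Xs Ys (f : hom X Y) (fs : fam hom Xs Ys) :
  tens_map (fcons f fs) ∘ tcons_inv X Xs = tcons_inv Y Ys ∘ (f ⊠ tens_map fs).
Proof. by rewrite tens_map_cons -!compA (proj2 (tconsK _ _)) comp_idr. Qed.

Lemma tsplit_cons X Xs Ys :
  tsplit (X :: Xs) Ys =
  tcons_inv X Xs ⊠ idm (tens Ys) ∘ assoc_inv X (tens Xs) (tens Ys)
    ∘ (idm X ⊠ tsplit Xs Ys) ∘ tcons X (Xs ++ Ys).
Proof. by []. Qed.

Lemma tens_alpha_cons Xs Xss :
  tens_alpha (Xs :: Xss) = tcons_inv (tens Xs) (map (@tens C) Xss)
    ∘ (idm (tens Xs) ⊠ tens_alpha Xss) ∘ tsplit Xs (concat Xss).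
Proof. by []. Qed.

Lemma tens_map_id Xs : tens_map (fam_id Xs) = idm (tens Xs).
Proof.
elim: Xs => [|X Xs IH] //; rewrite [fam_id _]/= tens_map_cons IH tensor_map_id.
by rewrite comp_idr (proj1 (tconsK X Xs)).
Qed.

Lemma tens_map_comp Xs Ys Zs (gs : fam hom Ys Zs) (fs : fam hom Xs Ys) :
  tens_map (fam_comp gs fs) = tens_map gs ∘ tens_map fs.
Proof.
elim: fs Zs gs => [|X Y Xs' Ys' f fs IH] Zs gs; dependent destruction gs.
  by rewrite comp_idl.
rewrite /fam_comp [fam_zip _ _ _]/= tens_map_cons (IH _ gs) tensor_map_comp.
by rewrite [tens_map (fcons r gs)]tens_map_cons -!compA tens_map_consr.
Qed.

Lemma lunit_inv_nat X Y (f : hom X Y) :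
  idm unit_ob ⊠ f ∘ lunit_inv X = lunit_inv Y ∘ f.
Proof.
apply: (inverse_mono (lunitK Y)); rewrite !compA lunit_nat (proj2 (lunitK Y)).
by rewrite -compA (proj2 (lunitK X)) comp_idl comp_idr.
Qed.

Lemma assoc_inv_nat X X' Y Y' Z Z' (f : hom X X') (g : hom Y Y') (h : hom Z Z') :
  f ⊠ g ⊠ h ∘ assoc_inv X Y Z = assoc_inv X' Y' Z' ∘ (f ⊠ (g ⊠ h)).
Proof.
apply: (inverse_mono (assocK _ _ _)); rewrite !compA assoc_nat.
by rewrite -compA !(proj2 (assocK _ _ _)) comp_idl comp_idr.
Qed.

Lemma tsplit_nat Xs Xs' Ys Ys' (fs : fam hom Xs Xs') (gs : fam hom Ys Ys') :
  tsplit Xs' Ys' ∘ tens_map (fam_app fs gs) =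
  tens_map fs ⊠ tens_map gs ∘ tsplit Xs Ys.
Proof.
elim: fs => [|X Y {}Xs {}Xs' f fs IH] /=; first by rewrite lunit_inv_nat.
rewrite !tsplit_cons (re2 (tens_map_consr _ _)) !compA.
rewrite -(compA _ (_ ⊠ tsplit _ _)) -tensor_map_comp IH comp_idl.
rewrite -[f in LHS]comp_idr tensor_map_comp !compA.
rewrite -(tensor_map_comp (tens_map (fcons f fs))) tens_map_consl comp_idr.
rewrite -(compA _ (assoc_inv _ _ _) (f ⊠ _)) -assoc_inv_nat !compA.
by rewrite -tensor_map_comp comp_idl.
Qed.

Lemma tens_alpha_nat Xss Yss (fss : fam (fam hom) Xss Yss) :
  tens_alpha Yss ∘ tens_map (fam_concat fss) =
  tens_map (fam_map (@tens_map C) fss) ∘ tens_alpha Xss.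
Proof.
elim: fss => [|Xs Ys {}Xss {}Yss fs fss IH] //=.
rewrite !tens_alpha_cons -compA tsplit_nat !compA -(compA (tcons_inv _ _)).
rewrite -tensor_map_comp IH comp_idl tens_map_consl.
rewrite -(compA _ (_ ⊠ tens_map _) (idm _ ⊠ _)).
by rewrite -tensor_map_comp comp_idr.
Qed.

Definition tcast Xs Ys (e : Xs = Ys) : hom (tens Xs) (tens Ys) :=
  idto (f_equal (@tens C) e).

Lemma tcast_refl Xs (e : Xs = Xs) : tcast e = idm (tens Xs).
Proof. exact: idto_refl. Qed.

Lemma tcons_cast X Xs Ys (e : X :: Xs = X :: Ys) (e' : Xs = Ys) :
  tcons X Ys ∘ tcast e = idm X ⊠ tcast e' ∘ tcons X Xs.
Proof. by subst; rewrite !tcast_refl tensor_map_id comp_idl comp_idr. Qed.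

Lemma tcast_comp Xs Ys Zs (e : Xs = Ys) (e' : Ys = Zs) :
  tcast e' ∘ tcast e = tcast (eq_trans e e').
Proof. by rewrite /tcast idto_comp; apply: idto_irr. Qed.

Lemma tcast_irr Xs Ys (e e' : Xs = Ys) : tcast e = tcast e'.
Proof. exact: idto_irr. Qed.

Lemma pentagon_inv X Y Z W :
  assoc (X ⊗ Y) Z W ∘ (assoc_inv X Y Z ⊠ idm W) ∘ assoc_inv X (Y ⊗ Z) W =
  assoc_inv X Y (Z ⊗ W) ∘ (idm X ⊠ assoc Y Z W).
Proof.
apply: (inverse_mono (assocK _ _ _)); rewrite !compA (proj2 (assocK _ _ _)).
rewrite comp_idl pentagon -(compA _ (_ ⊠ _) (_ ⊠ _)) -tensor_map_compl.
rewrite (proj2 (assocK _ _ _)) tensor_map_id comp_idr -compA.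
by rewrite (proj2 (assocK _ _ _)) comp_idr.
Qed.

Lemma lunit_inv_tensor X Y :
  assoc unit_ob X Y ∘ (lunit_inv X ⊠ idm Y) = lunit_inv (X ⊗ Y).
Proof.
apply: (inverse_mono (lunitK _)); rewrite compA lunit_tensor -tensor_map_compl.
by rewrite !(proj2 (lunitK _)) tensor_map_id.
Qed.

Lemma tsplit_assoc Xs Ys Zs (e : (Xs ++ Ys) ++ Zs = Xs ++ Ys ++ Zs) :
  assoc (tens Xs) (tens Ys) (tens Zs) ∘ (tsplit Xs Ys ⊠ idm (tens Zs))
    ∘ tsplit (Xs ++ Ys) Zs =
  idm (tens Xs) ⊠ tsplit Ys Zs ∘ tsplit Xs (Ys ++ Zs) ∘ tcast e.
Proof.
elim: Xs e => [|X Xs IH] e /=.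
  by rewrite tcast_refl comp_idr lunit_inv_nat lunit_inv_tensor.
have e' : (Xs ++ Ys) ++ Zs = Xs ++ Ys ++ Zs by rewrite app_assoc.
rewrite !tsplit_cons !compA (re2 (tcons_cast e e')) !compA.
rewrite -(compA _ (idm X ⊠ _) (idm X ⊠ _)) -tensor_map_compr.
have -> : idm (tens (X :: Xs)) ⊠ tsplit Ys Zs
  ∘ (tcons_inv X Xs ⊠ idm (tens (Ys ++ Zs))) =
  tcons_inv X Xs ⊠ idm _ ∘ (idm X ⊠ idm (tens Xs) ⊠ tsplit Ys Zs).
  by rewrite tensor_map_id -!tensor_map_comp !comp_idl !comp_idr.
rewrite -(compA _ (_ ⊠ tsplit Ys Zs) (assoc_inv _ _ _)) assoc_inv_nat !compA.
rewrite -(compA _ (idm X ⊠ _) (idm X ⊠ _)) -tensor_map_compr compA -IH.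
rewrite !tensor_map_compl !tensor_map_compr !compA.
rewrite -(compA _ (tcons X _ ⊠ _)) -tensor_map_compl (proj2 (tconsK _ _)).
rewrite tensor_map_id comp_idr assoc_nat tensor_map_id.
rewrite -(compA _ (_ ⊠ idm (tens Zs)) (assoc_inv _ _ _)) assoc_inv_nat !compA.
by rewrite (re3 (pentagon_inv _ _ _ _)) !compA.
Qed.

Lemma tsplit_assoc_sym Xs Ys Zs (e : Xs ++ Ys ++ Zs = (Xs ++ Ys) ++ Zs) :
  idm (tens Xs) ⊠ tsplit Ys Zs ∘ tsplit Xs (Ys ++ Zs) =
  assoc (tens Xs) (tens Ys) (tens Zs) ∘ (tsplit Xs Ys ⊠ idm (tens Zs))
    ∘ tsplit (Xs ++ Ys) Zs ∘ tcast e.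
Proof.
by rewrite (tsplit_assoc (eq_sym e)) -compA tcast_comp tcast_refl comp_idr.
Qed.

Lemma tsplit_cast Xs Xs' Ys Ys' (e : Xs = Xs') (e' : Ys = Ys') e'' :
  tsplit Xs' Ys' ∘ tcast e'' = tcast e ⊠ tcast e' ∘ tsplit Xs Ys.
Proof. by subst; rewrite !tcast_refl tensor_map_id comp_idl comp_idr. Qed.

Lemma tens_alpha_app Xss Yss
    (e : map (@tens C) (Xss ++ Yss) = map (@tens C) Xss ++ map (@tens C) Yss)
    (e' : concat (Xss ++ Yss) = concat Xss ++ concat Yss) :
  tsplit (map (@tens C) Xss) (map (@tens C) Yss) ∘ tcast e ∘ tens_alpha (Xss ++ Yss) =
  tens_alpha Xss ⊠ tens_alpha Yss ∘ tsplit (concat Xss) (concat Yss) ∘ tcast e'.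
Proof.
elim: Xss e e' => [|Xs Xss IH] e e' /=.
  by rewrite !tcast_refl !comp_idr lunit_inv_nat.
have e1 : map (@tens C) (Xss ++ Yss) = map (@tens C) Xss ++ map (@tens C) Yss.
  exact: map_app.
have e2 : concat (Xss ++ Yss) = concat Xss ++ concat Yss by exact: concat_app.
have e3 : (Xs ++ concat Xss) ++ concat Yss = Xs ++ concat Xss ++ concat Yss.
  by rewrite app_assoc.
have e4 : Xs ++ concat (Xss ++ Yss) = Xs ++ concat Xss ++ concat Yss by rewrite e2.
rewrite tsplit_cons !tens_alpha_cons !compA (re2 (tcons_cast e e1)) !compA.
rewrite -(compA _ (tcons _ _)) (proj2 (tconsK _ _)) comp_idr.
rewrite -(compA _ (_ ⊠ tcast _)) -tensor_map_compr.
rewrite -(compA _ (_ ⊠ tsplit _ _)) -tensor_map_compr compA (IH e1 e2) !tensor_map_compr !compA.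
have E := tsplit_cast (eq_refl Xs) e2 e4; rewrite tcast_refl in E.
rewrite -(compA _ (_ ⊠ tcast _)) -E !compA (re2 (tsplit_assoc_sym (eq_sym e3))).
rewrite -(compA _ (assoc_inv _ _ _)) -assoc_inv_nat !compA.
rewrite -(compA _ (assoc_inv _ _ _)) (proj1 (assocK _ _ _)) comp_idr.
rewrite -!tensor_map_comp !comp_idl !comp_idr -compA tcast_comp.
by congr (_ ∘ _); apply: tcast_irr.
Qed.

Lemma tsplit_nil_r Xs (e : Xs ++ [] = Xs) :
  runit (tens Xs) ∘ tsplit Xs [] = tcast e.
Proof.
elim: Xs e => [|X Xs IH] e /=.
  by rewrite tcast_refl -lunit_runit (proj2 (lunitK _)).
have e' : Xs ++ [] = Xs by rewrite app_nil_r.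
rewrite tsplit_cons !compA runit_nat -runit_tensor !compA.
rewrite -(compA _ (assoc _ _ _)).
rewrite (proj2 (assocK _ _ _)) comp_idr -(compA _ (_ ⊠ runit _)) -tensor_map_compr.
rewrite (IH e') -compA -(tcons_cast e) compA (proj1 (tconsK _ _)) comp_idl //.
Qed.

Lemma tsplit_sing X Xs : tsplit [X] Xs = tcons X Xs.
Proof.
rewrite tsplit_cons -[RHS]comp_idl; congr (_ ∘ _).
rewrite -[tcons_inv _ _]/(runit X) -triangle -[tsplit [] _]/(lunit_inv _).
rewrite -(compA _ _ (assoc_inv _ _ _)) (proj2 (assocK _ _ _)) comp_idr.
by rewrite -tensor_map_compr (proj2 (lunitK _)) tensor_map_id.
Qed.

Lemma tens_counit_l Xs :
  idm (tens Xs) ∘ tens_alpha [Xs] = tcast (app_nil_r Xs).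
Proof.
rewrite comp_idl tens_alpha_cons -[tens_alpha []]/(idm _) tensor_map_id comp_idr.
exact: tsplit_nil_r.
Qed.

Lemma tens_counit_r Xs :
  tens_map (fam_mapl (f := @tens C)
    (fam_mapl (f := @sing C) (fam_diag (fun X : C => idm X) Xs)))
      ∘ tens_alpha (map (@sing C) Xs) = tcast (concat_sing Xs).
Proof.
move: (concat_sing _); elim: Xs => [|X Xs IH] e /=.
  by rewrite tcast_refl comp_idl.
rewrite tens_alpha_cons -[sing X]/[X] tsplit_sing !compA tens_map_consl.
rewrite -(compA _ (_ ⊠ tens_map _)) -tensor_map_comp.
rewrite (IH (concat_sing _)) comp_idl.
rewrite -compA -(tcons_cast e) compA (proj1 (tconsK _ _)) comp_idl //.
Qed.

Lemma tens_coassoc Xsss :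
  tens_alpha (map (map (@tens C)) Xsss) ∘ tcast (concat_map (@tens C) Xsss)
    ∘ tens_alpha (concat Xsss) =
  tens_map (fam_map (f := @tens C) (g := @tens C) (fun _ _ f => f)
              (fam_tab (R := fun Xs Ys => hom (tens Xs) (tens Ys))
                 (f := @concat C) (g := map (@tens C)) (@tens_alpha C) Xsss))
    ∘ tens_alpha (map (@concat C) Xsss) ∘ tcast (concat_concat Xsss).
Proof.
move: (concat_map _ _) (concat_concat _).
elim: Xsss => [|Xss Xsss IH] e e'; first by rewrite /= !tcast_refl.
have e1 : map (@tens C) (Xss ++ concat Xsss) =
          map (@tens C) Xss ++ map (@tens C) (concat Xsss) by exact: map_app.
have e2 : map (@tens C) (concat Xsss) = concat (map (map (@tens C)) Xsss).
  exact: concat_map.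
have e3 : map (@tens C) Xss ++ map (@tens C) (concat Xsss) =
          map (@tens C) Xss ++ concat (map (map (@tens C)) Xsss) by rewrite e2.
have e4 : concat (Xss ++ concat Xsss) = concat Xss ++ concat (concat Xsss).
  exact: concat_app.
have e5 : concat (concat Xsss) = concat (map (@concat C) Xsss).
  exact: concat_concat.
have e6 : concat Xss ++ concat (concat Xsss) =
          concat Xss ++ concat (map (@concat C) Xsss) by rewrite e5.
have E3 := tsplit_cast (eq_refl (map (@tens C) Xss)) e2 e3.
have E6 := tsplit_cast (eq_refl (concat Xss)) e5 e6.
rewrite !tcast_refl in E3 E6.
have H := IH e2 e5; have A := tens_alpha_app e1 e4.
rewrite -[concat (Xss :: Xsss)]/(Xss ++ concat Xsss) in e e' *.
rewrite -[map (map _) (_ :: _)]/(map (@tens C) Xss :: map (map (@tens C)) Xsss).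
rewrite -[map (@concat _) (_ :: _)]/(concat Xss :: map (@concat C) Xsss).
rewrite [fam_tab _ _]/= [fam_map _ _]/= !tens_alpha_cons.
have -> : tcast e = tcast e3 ∘ tcast e1 by rewrite tcast_comp; apply: tcast_irr.
have -> : tcast e' = tcast e6 ∘ tcast e4 by rewrite tcast_comp; apply: tcast_irr.
rewrite !compA (re2 E3) !compA (re3 A) !compA -(compA _ _ (tcast e6)) E6 !compA.
congr (_ ∘ _); congr (_ ∘ _).
rewrite tens_map_consl -!compA -!tensor_map_comp !comp_idl !comp_idr.
by congr (_ ∘ (_ ⊠ _)); rewrite !compA.
Qed.

Lemma tens_eps_nat X Y (f : hom X Y) :
  idm Y ∘ tens_map (fcons f fnil) = f ∘ idm X.
Proof. by rewrite comp_idl comp_idr. Qed.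

(* [C] as a colax monoidal category, with [epsilon] the identity. *)
Definition tens_colax : ColaxMonoidal C :=
  @Build_ColaxMonoidal C (@tens C) (@tens_map C) tens_map_id tens_map_comp
    (fun X => idm X) tens_eps_nat (@tens_alpha C) tens_alpha_nat tens_coassoc
    tens_counit_l tens_counit_r.

Lemma tens_colax_normal : normal tens_colax.
Proof. by move=> X; exists (idm X); exact: id_inverse. Qed.

End Tens.

(** * Multicategories with a faithful functor to a given multicategory *)

Section SubMulticategory.
Variables (M : Multicategory) (O : Type) (o : O -> M).
Variable P : forall (Vs : list O) (W : O), mhom (map o Vs) (o W) -> Prop.

Definition sub_mhom (Vs : list O) (W : O) := {f : mhom (map o Vs) (o W) | P f}.

Definition sub_forget Vss Ws (fs : fam sub_mhom Vss Ws) :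
    fam mhom (map (map o) Vss) (map o Ws) :=
  fam_map (f := map o) (g := o) (fun _ _ f => proj1_sig f) fs.

Definition sub_compose Vss Ws Z (g : sub_mhom Ws Z) (fs : fam sub_mhom Vss Ws) :
    mhom (map o (concat Vss)) (o Z) :=
  hcast (eq_sym (concat_map o Vss)) (mcomp (proj1_sig g) (sub_forget fs)).

Hypothesis P_id : forall V, @P [V] V (mid (o V)).
Hypothesis P_comp : forall Vss Ws Z (g : sub_mhom Ws Z) (fs : fam sub_mhom Vss Ws),
  P (sub_compose g fs).

Definition sub_mid V : sub_mhom [V] V := exist _ (mid (o V)) (P_id V).
Definition sub_mcomp Vss Ws Z (g : sub_mhom Ws Z) (fs : fam sub_mhom Vss Ws) :
  sub_mhom (concat Vss) Z := exist _ (sub_compose g fs) (P_comp g fs).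

Lemma sub_mhom_eq Vs W (f g : sub_mhom Vs W) : proj1_sig f = proj1_sig g -> f = g.
Proof. by apply: eq_sig_hprop => x; exact: proof_irrelevance. Qed.

Lemma sub_hcast Vs Vs' W (e : Vs = Vs') (f : sub_mhom Vs W) :
  proj1_sig (hcast e f) = hcast (f_equal (map o) e) (proj1_sig f).
Proof. by subst. Qed.

Lemma sub_mcomp_idl Vs W (f : sub_mhom Vs W) :
  hcast (app_nil_r Vs) (sub_mcomp (sub_mid W) (fcons f fnil)) = f.
Proof.
apply: sub_mhom_eq; rewrite sub_hcast /= /sub_compose hcast_comp.
by rewrite -[RHS]mcomp_idl; apply: hcast_irr.
Qed.

Lemma sub_forget_sing Vs e :
  sub_forget (fam_mapl (f := @sing O) (fam_diag sub_mid Vs)) =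
  fcast e eq_refl (fam_mapl (f := @sing M) (fam_diag (@mid M) (map o Vs))).
Proof.
elim: Vs e => [|V Vs IH] e /=; first by rewrite fcast_refl.
have el : map (@sing M) (map o Vs) = map (map o) (map (@sing O) Vs) by case: e.
by rewrite (fcast_cons eq_refl eq_refl el eq_refl) -IH.
Qed.

Lemma sub_mcomp_idr Vs W (f : sub_mhom Vs W) :
  hcast (concat_sing Vs)
    (sub_mcomp f (fam_mapl (f := @sing O) (fam_diag sub_mid Vs))) = f.
Proof.
apply: sub_mhom_eq; rewrite sub_hcast /= /sub_compose hcast_comp.
have e : map (@sing M) (map o Vs) = map (map o) (map (@sing O) Vs).
  by rewrite !map_map.
rewrite -[RHS]mcomp_idr (sub_forget_sing e).
rewrite -[proj1_sig f in LHS](hcast_refl eq_refl) mcomp_fcast hcast_comp.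
exact: hcast_irr.
Qed.

Definition sub_forgets Vsss Wss (fss : fam (fam sub_mhom) Vsss Wss) :
    fam (fam mhom) (map (map (map o)) Vsss) (map (map o) Wss) :=
  fam_map (f := map (map o)) (g := map o) sub_forget fss.

Lemma sub_forget_zip Vsss Wss Zs (fss : fam (fam sub_mhom) Vsss Wss)
    (gs : fam sub_mhom Wss Zs) e :
  sub_forget (fam_mapl (f := @concat O)
     (fam_zip (fun _ _ _ fs g => sub_mcomp g fs) fss gs)) =
  fcast e eq_refl (fam_mapl (f := @concat M)
     (fam_zip (fun _ _ _ fs g => mcomp g fs) (sub_forgets fss) (sub_forget gs))).
Proof.
elim: fss Zs gs e => [|Vss Ws {}Vsss {}Wss fs fss IH] Zs gs; dependent destruction gs.
  by move=> e; rewrite fcast_refl.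
move=> e /=.
have el : map (@concat M) (map (map (map o)) Vsss) =
          map (map o) (map (@concat O) Vsss) by case: e.
rewrite (fcast_cons (eq_sym (concat_map o Vss)) eq_refl el eq_refl) -IH.
by [].
Qed.

Lemma sub_mcompA Vsss Wss Zs X (h : sub_mhom Zs X) (gs : fam sub_mhom Wss Zs)
    (fss : fam (fam sub_mhom) Vsss Wss) :
  hcast (concat_concat Vsss) (sub_mcomp (sub_mcomp h gs) (fam_concat fss)) =
  sub_mcomp h (fam_mapl (f := @concat O)
     (fam_zip (fun _ _ _ fs g => sub_mcomp g fs) fss gs)).
Proof.
apply: sub_mhom_eq; rewrite sub_hcast /= /sub_compose /= /sub_compose.
have e : map (@concat M) (map (map (map o)) Vsss) =
         map (map o) (map (@concat O) Vsss).
  by rewrite !map_map; apply: map_ext => Vss; rewrite concat_map.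
rewrite (sub_forget_zip _ _ e) [sub_forget (fam_concat _)]/sub_forget.
rewrite (fam_map_concat _ _ (eq_sym (concat_map (map o) Vsss))
           (eq_sym (concat_map o Wss))) mcomp_fcast.
rewrite -[proj1_sig h in RHS](hcast_refl eq_refl) mcomp_fcast -mcompA !hcast_comp.
exact: hcast_irr.
Qed.

Definition sub_multicat : Multicategory :=
  @Build_Multicategory O sub_mhom sub_mid sub_mcomp sub_mcomp_idl sub_mcomp_idr
    sub_mcompA.

End SubMulticategory.

(** * Lax monoidal functors *)

Record LaxMonoidal (C D : MonoidalCategory) (F : Functor C D) := {
  lax : forall X Y : C, hom (F X ⊗ F Y) (F (X ⊗ Y));
  lax_unit : hom (unit_ob : D) (F unit_ob);
  lax_nat : forall (X X' Y Y' : C) (f : hom X X') (g : hom Y Y'),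
    lax X' Y' ∘ (fmap F f ⊠ fmap F g) = fmap F (f ⊠ g) ∘ lax X Y;
  lax_assoc : forall X Y Z : C,
    fmap F (assoc X Y Z) ∘ lax (X ⊗ Y) Z ∘ (lax X Y ⊠ idm (F Z)) =
    lax X (Y ⊗ Z) ∘ (idm (F X) ⊠ lax Y Z) ∘ assoc (F X) (F Y) (F Z);
  lax_lunit : forall X : C,
    fmap F (lunit X) ∘ lax unit_ob X ∘ (lax_unit ⊠ idm (F X)) = lunit (F X);
  lax_runit : forall X : C,
    fmap F (runit X) ∘ lax X unit_ob ∘ (idm (F X) ⊠ lax_unit) = runit (F X)
}.
Arguments lax {C D F} _ _ _.
Arguments lax_unit {C D F} _.

Section LaxIter.
Variables (C D : MonoidalCategory) (F : Functor C D) (p : LaxMonoidal F).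

Fixpoint lax_iter (Xs : list C) : hom (tens (map F Xs)) (F (tens Xs)) :=
  match Xs return hom (tens (map F Xs)) (F (tens Xs)) with
  | [] => lax_unit p
  | X :: Xs =>
      match Xs return hom (tens (map F Xs)) (F (tens Xs)) ->
                      hom (tens (F X :: map F Xs)) (F (tens (X :: Xs))) with
      | [] => fun _ => idm (F X)
      | Y :: Ys => fun q => lax p X (tens (Y :: Ys)) ∘ (idm (F X) ⊠ q)
      end (lax_iter Xs)
  end.
Arguments lax_iter : simpl never.

Lemma lax_iter_cons X Xs :
  lax_iter (X :: Xs) =
  fmap F (tcons_inv X Xs) ∘ lax p X (tens Xs) ∘ (idm (F X) ⊠ lax_iter Xs)
    ∘ tcons (F X) (map F Xs).
Proof.
case: Xs => [|Y Ys]; last by rewrite /tcons_inv /tcons fmap_id comp_idl comp_idr.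
by rewrite /tcons_inv /tcons /= lax_runit (proj2 (runitK _)).
Qed.

Lemma fmap_tconsK X Xs : fmap F (tcons X Xs) ∘ fmap F (tcons_inv X Xs) = idm _.
Proof. by rewrite -fmap_comp (proj2 (tconsK _ _)) fmap_id. Qed.

Lemma fmap_inverse (X Y : C) (f : hom X Y) g :
  is_inverse f g -> is_inverse (fmap F f) (fmap F g).
Proof. by case=> a b; split; rewrite -fmap_comp ?a ?b fmap_id. Qed.

Lemma lax_iter_consr X Xs :
  fmap F (tcons X Xs) ∘ lax_iter (X :: Xs) =
  lax p X (tens Xs) ∘ (idm (F X) ⊠ lax_iter Xs) ∘ tcons (F X) (map F Xs).
Proof. by rewrite lax_iter_cons !compA fmap_tconsK comp_idl. Qed.

Lemma lax_iter_consl X Xs :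
  lax_iter (X :: Xs) ∘ tcons_inv (F X) (map F Xs) =
  fmap F (tcons_inv X Xs) ∘ lax p X (tens Xs) ∘ (idm (F X) ⊠ lax_iter Xs).
Proof.
by rewrite lax_iter_cons -!compA (proj2 (tconsK _ _)) comp_idr.
Qed.

Lemma lax_iter_nat Xs Ys (fs : fam hom Xs Ys) :
  lax_iter Ys ∘ tens_map (fam_map (@fmap _ _ F) fs) =
  fmap F (tens_map fs) ∘ lax_iter Xs.
Proof.
elim: fs => [|X Y {}Xs {}Ys f fs IH] /=.
  by rewrite fmap_id comp_idl comp_idr.
apply: (inverse_mono (fmap_inverse (tconsK _ _))).
rewrite !compA lax_iter_consr -[in RHS]fmap_comp tens_map_consr fmap_comp.
rewrite -!compA lax_iter_consr tens_map_consr !compA -lax_nat.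
rewrite -(compA _ (_ ⊠ lax_iter _) (_ ⊠ tens_map _)) -tensor_map_comp IH.
rewrite comp_idl -(compA _ (_ ⊠ fmap _ _)) -tensor_map_comp comp_idr //.
Qed.

Lemma lax_assoc_inv X Y Z :
  fmap F (assoc_inv X Y Z) ∘ lax p X (Y ⊗ Z) ∘ (idm (F X) ⊠ lax p Y Z) =
  lax p (X ⊗ Y) Z ∘ (lax p X Y ⊠ idm (F Z)) ∘ assoc_inv (F X) (F Y) (F Z).
Proof.
apply: (inverse_mono (fmap_inverse (assocK _ _ _))).
rewrite !compA -fmap_comp (proj2 (assocK _ _ _)) fmap_id comp_idl lax_assoc.
by rewrite -!compA (proj2 (assocK _ _ _)) comp_idr.
Qed.

Lemma lax_lunit_inv X :
  fmap F (lunit_inv X) = 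
  lax p unit_ob X ∘ (lax_unit p ⊠ idm (F X)) ∘ lunit_inv (F X).
Proof.
apply: (inverse_mono (fmap_inverse (lunitK X))).
rewrite -fmap_comp (proj2 (lunitK _)) fmap_id !compA lax_lunit.
by rewrite (proj2 (lunitK _)).
Qed.

Lemma lax_iter_split Xs Ys (e : map F (Xs ++ Ys) = map F Xs ++ map F Ys) :
  fmap F (tsplit Xs Ys) ∘ lax_iter (Xs ++ Ys) =
  lax p (tens Xs) (tens Ys) ∘ (lax_iter Xs ⊠ lax_iter Ys)
    ∘ tsplit (map F Xs) (map F Ys) ∘ tcast e.
Proof.
elim: Xs e => [|X Xs IH] e /=.
  rewrite tcast_refl comp_idr -[tsplit [] Ys]/(lunit_inv _).
  rewrite -[tsplit [] _]/(lunit_inv _) lax_lunit_inv -[lax_iter []]/(lax_unit p).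
  rewrite -[lax_unit p in RHS]comp_idr -[lax_iter Ys in RHS]comp_idl.
  by rewrite tensor_map_comp -!compA lunit_inv_nat.
have e' : map F (Xs ++ Ys) = map F Xs ++ map F Ys by exact: map_app.
rewrite !tsplit_cons !fmap_comp -!compA lax_iter_consr !compA.
rewrite -(compA _ (fmap F (_ ⊠ tsplit _ _))) -lax_nat fmap_id !compA.
rewrite -(compA _ (_ ⊠ fmap _ _)) -tensor_map_comp (IH e') comp_idl.
rewrite !tensor_map_compr !compA -(compA _ (_ ⊠ tcast _)) -(tcons_cast e) !compA.
congr (_ ∘ _); congr (_ ∘ _); rewrite (re3 (lax_assoc_inv _ _ _)) !compA.
rewrite -(compA _ (assoc_inv _ _ _)) -assoc_inv_nat !compA; congr (_ ∘ _).
rewrite -lax_nat fmap_id.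
rewrite -(compA _ (lax_iter (X :: Xs) ⊠ _) (tcons_inv _ _ ⊠ _)).
rewrite -(tensor_map_comp (lax_iter (X :: Xs))).
rewrite lax_iter_consl comp_idr; congr (_ ∘ _).
by rewrite -!compA -!tensor_map_comp !compA !comp_idl.
Qed.

Lemma lax_iter_cast Xs Ys (e : Xs = Ys) :
  lax_iter Ys ∘ tcast (f_equal (map F) e) = fmap F (tcast e) ∘ lax_iter Xs.
Proof. by subst; rewrite !tcast_refl fmap_id comp_idl comp_idr. Qed.

Lemma lax_iter_alpha Xss :
  fmap F (tens_alpha Xss) ∘ lax_iter (concat Xss) =
  lax_iter (map (@tens C) Xss)
    ∘ tens_map (fam_map (f := @tens D) (g := F) (fun _ _ f => f)
                  (fam_tab (R := fun Xs V => hom (tens Xs) (F V))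
                     (f := map F) (g := @tens C) lax_iter Xss))
    ∘ tens_alpha (map (map F) Xss) ∘ tcast (concat_map F Xss).
Proof.
move: (concat_map _ _); elim: Xss => [|Xs Xss IH] e /=.
  by rewrite tcast_refl fmap_id comp_idl !comp_idr.
have e1 : map F (Xs ++ concat Xss) = map F Xs ++ map F (concat Xss).
  exact: map_app.
have e2 : map F (concat Xss) = concat (map (map F) Xss) by exact: concat_map.
have e3 : map F Xs ++ map F (concat Xss) = map F Xs ++ concat (map (map F) Xss).
  by rewrite e2.
have E3 := tsplit_cast (eq_refl (map F Xs)) e2 e3; rewrite tcast_refl in E3.
have -> : tcast e = tcast e3 ∘ tcast e1 by rewrite tcast_comp; apply: tcast_irr.
rewrite !tens_alpha_cons !fmap_comp -!compA (lax_iter_split e1) !compA.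
rewrite -(compA _ (fmap F (_ ⊠ tens_alpha _))) -lax_nat fmap_id.
rewrite -(compA _ _ (lax_iter Xs ⊠ _)) -(compA (lax _ _ _)) -tensor_map_comp.
rewrite (IH e2) comp_idl.
rewrite -(compA _ (tens_map (fcons _ _))) tens_map_consl !compA lax_iter_consl.
rewrite -(compA _ (tsplit _ _) (tcast e3)) E3 !compA.
congr (_ ∘ _); congr (_ ∘ _); rewrite -!compA -!tensor_map_comp.
by rewrite !comp_idl !comp_idr !compA.
Qed.

Lemma lax_iter_eps X : fmap F (idm X) ∘ lax_iter [X] = idm (F X).
Proof. by rewrite fmap_id comp_idl. Qed.

Definition lax_colax : ColaxMonoidalFunctor (tens_colax C) (tens_colax D) F :=
  @Build_ColaxMonoidalFunctor C D (tens_colax C) (tens_colax D) F lax_iter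
    lax_iter_nat lax_iter_alpha lax_iter_eps.

End LaxIter.

(** * Monads and their algebras *)

Record Monad (C : Category) := {
  mfun :> Functor C C;
  eta : forall X, hom X (mfun X);
  mu : forall X, hom (mfun (mfun X)) (mfun X);
  eta_nat : forall X Y (f : hom X Y), eta Y ∘ f = fmap mfun f ∘ eta X;
  mu_nat : forall X Y (f : hom X Y),
    mu Y ∘ fmap mfun (fmap mfun f) = fmap mfun f ∘ mu X;
  mu_eta : forall X, mu X ∘ eta (mfun X) = idm (mfun X);
  mu_fmap_eta : forall X, mu X ∘ fmap mfun (eta X) = idm (mfun X);
  mu_mu : forall X, mu X ∘ mu (mfun X) = mu X ∘ fmap mfun (mu X)
}.
Arguments eta {C} _ _.
Arguments mu {C} _ _.

(* The last four fields say that [eta : Id -> T] and [mu : T T -> T] are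
   morphisms of monoidal functors. *)
Record MonoidalMonad (C : MonoidalCategory) := {
  mmonad :> Monad C;
  mlax : LaxMonoidal mmonad;
  eta_tensor : forall X Y : C,
    lax mlax X Y ∘ (eta mmonad X ⊠ eta mmonad Y) = eta mmonad (X ⊗ Y);
  eta_unit : lax_unit mlax = eta mmonad unit_ob;
  mu_tensor : forall X Y : C,
    mu mmonad (X ⊗ Y) ∘ (fmap mmonad (lax mlax X Y) ∘ lax mlax (mmonad X) (mmonad Y)) =
    lax mlax X Y ∘ (mu mmonad X ⊠ mu mmonad Y);
  mu_unit : mu mmonad unit_ob ∘ (fmap mmonad (lax_unit mlax) ∘ lax_unit mlax) =
    lax_unit mlax
}.
Arguments mlax {C} _.

Record Algebra (C : Category) (T : Monad C) := {
  carrier :> C;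
  action : hom (T carrier) carrier;
  action_eta : action ∘ eta T carrier = idm carrier;
  action_mu : action ∘ mu T carrier = action ∘ fmap T action
}.
Arguments action {C T} _.

Section AlgebraCategory.
Variables (C : Category) (T : Monad C).
Implicit Types V W : Algebra T.

Definition alg_hom V W := {f : hom V W | f ∘ action V = action W ∘ fmap T f}.

Lemma alg_hom_eq V W (f g : alg_hom V W) : proj1_sig f = proj1_sig g -> f = g.
Proof. by apply: eq_sig_hprop => x; exact: proof_irrelevance. Qed.

Definition alg_id V : alg_hom V V.
Proof. by exists (idm (carrier V)); rewrite fmap_id comp_idl comp_idr. Defined.

Definition alg_comp V W X (g : alg_hom W X) (f : alg_hom V W) : alg_hom V X.
Proof.
exists (proj1_sig g ∘ proj1_sig f).
by rewrite -compA (proj2_sig f) compA (proj2_sig g) -compA fmap_comp.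
Defined.

Definition algebras : Category.
Proof.
refine (@Build_Category (Algebra T) alg_hom alg_id alg_comp _ _ _);
  move=> *; apply: alg_hom_eq => /=.
- exact: comp_idl.
- exact: comp_idr.
- exact: compA.
Defined.

Definition forgetful : Functor algebras C :=
  @Build_Functor algebras C (@carrier C T) (fun V W f => proj1_sig f)
    (fun V => eq_refl) (fun V W X g f => eq_refl).

End AlgebraCategory.

(** * Multilinear maps *)

Section Multilinear.
Variables (C : MonoidalCategory) (T : MonoidalMonad C).

Definition actions (Vs : list (Algebra T)) :
    fam hom (map T (map (@carrier C T) Vs)) (map (@carrier C T) Vs) :=
  fam_mapl (f := T) (fam_tab (R := fun X Y => hom (T X) Y) (@action C T) Vs).

Definition multilinear (Vs : list (Algebra T)) (W : Algebra T)
    (f : hom (tens (map (@carrier C T) Vs)) W) : Prop :=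
  action W ∘ fmap T f ∘ lax_iter (mlax T) (map (@carrier C T) Vs) =
  f ∘ tens_map (actions Vs).

Lemma multilinear_id V : @multilinear [V] V (idm (carrier V)).
Proof. by rewrite /multilinear fmap_id !comp_idr comp_idl. Qed.

Lemma multilinear_cast Xs Ys (e : Xs = Ys) Z 
   (f : @mhom (multicat_of_colax (tens_colax C)) Xs Z) :
  hcast e f = (f : hom (tens Xs) Z) ∘ tcast (eq_sym e).
Proof. by subst; rewrite tcast_refl comp_idr. Qed.

Lemma tens_map_fcast Xs Xs' Ys Ys' (e : Xs = Xs') (e' : Ys = Ys')
    (fs : @fam C C hom Xs Ys) :
  tcast e' ∘ tens_map fs = tens_map (fcast e e' fs) ∘ tcast e.
Proof. by subst; rewrite !tcast_refl comp_idl comp_idr. Qed.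

Fixpoint actionss (Vss : list (list (Algebra T))) :
    fam (fam hom) (map (map T) (map (map (@carrier C T)) Vss))
      (map (map (@carrier C T)) Vss) :=
  match Vss with
  | [] => fnil
  | Vs :: Vss => fcons (actions Vs) (actionss Vss)
  end.

Lemma actions_app Vs Ws e e' :
  actions (Vs ++ Ws) = fcast e e' (fam_app (actions Vs) (actions Ws)).
Proof.
elim: Vs e e' => [|V Vs IH] e e' /=; first by rewrite fcast_refl.
have el : map T (map (@carrier C T) Vs) ++ map T (map (@carrier C T) Ws) =
          map T (map (@carrier C T) (Vs ++ Ws)) by case: e.
have em : map (@carrier C T) Vs ++ map (@carrier C T) Ws =
          map (@carrier C T) (Vs ++ Ws) by case: e'.
by rewrite (fcast_cons eq_refl eq_refl el em) -IH.
Qed.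

Lemma actions_concat Vss e e' :
  fcast e e' (actions (concat Vss)) = fam_concat (actionss Vss).
Proof.
elim: Vss e e' => [|Vs Vss IH] e e' /=; first by rewrite fcast_refl.
have a : map (@carrier C T) Vs ++ map (@carrier C T) (concat Vss) =
  map (@carrier C T) (Vs ++ concat Vss) by rewrite map_app.
have b : map T (map (@carrier C T) Vs) ++ map T (map (@carrier C T) (concat Vss)) =
  map T (map (@carrier C T) (Vs ++ concat Vss)) by rewrite !map_app.
have c : map (@carrier C T) (concat Vss) = concat (map (map (@carrier C T)) Vss).
  exact: concat_map.
have d : map T (map (@carrier C T) (concat Vss)) =
         concat (map (map T) (map (map (@carrier C T)) Vss)).
  by rewrite c concat_map.
rewrite (actions_app b a) fcast_comp -(IH d c).
have e1 : map T (map (@carrier C T) Vs) ++ map T (map (@carrier C T) (concat Vss)) =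
  map T (map (@carrier C T) Vs) ++ concat (map (map T) (map (map (@carrier C T)) Vss)).
  by rewrite d.
have e2 : map (@carrier C T) Vs ++ map (@carrier C T) (concat Vss) =
  map (@carrier C T) Vs ++ concat (map (map (@carrier C T)) Vss) by rewrite c.
rewrite (fam_app_fcast _ _ _ _ e1 e2); exact: fcast_irr.
Qed.

Let MC := multicat_of_colax (tens_colax C).

Definition multilinear_map : list (Algebra T) -> Algebra T -> Type :=
  @sub_mhom MC (Algebra T) (@carrier C T) multilinear.

Lemma multilinear_fam Vss Ws (fs : fam multilinear_map Vss Ws) :
  let F := fam_mapl (R := hom) (f := @tens C)
             (@sub_forget MC _ _ multilinear Vss Ws fs) in
  fam_comp (fam_comp (actions Ws) (fam_map (@fmap _ _ T) F))
   (fam_map (f := @tens C) (g := T) (fun _ _ f => f)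
      (fam_tab (R := fun Xs V => hom (tens Xs) (T V)) (f := map T) (g := @tens C)
         (lax_iter (mlax T)) (map (map (@carrier C T)) Vss))) =
  fam_comp F (fam_map (@tens_map C) (actionss Vss)).
Proof.
elim: fs => [|Vs W {}Vss {}Ws f fs IH] //=.
rewrite /fam_comp /=; f_equal; last exact: IH.
by case: f => f Hf.
Qed.

Lemma multilinear_comp_tens (Vss : list (list (Algebra T))) (Ws : list (Algebra T))
    (Z : Algebra T) (g : hom (tens (map (@carrier C T) Ws)) Z)
    (F : fam hom (map (@tens C) (map (map (@carrier C T)) Vss)) (map (@carrier C T) Ws))
    (e : map (@carrier C T) (concat Vss) = concat (map (map (@carrier C T)) Vss)) :
  multilinear g ->
  fam_comp (fam_comp (actions Ws) (fam_map (@fmap _ _ T) F))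
   (fam_map (f := @tens C) (g := T) (fun _ _ f => f)
      (fam_tab (R := fun Xs V => hom (tens Xs) (T V)) (f := map T) (g := @tens C)
         (lax_iter (mlax T)) (map (map (@carrier C T)) Vss))) =
  fam_comp F (fam_map (@tens_map C) (actionss Vss)) ->
  multilinear (g ∘ tens_map F ∘ tens_alpha _ ∘ tcast e).
Proof.
rewrite /multilinear => Hg H.
have d : map T (map (@carrier C T) (concat Vss)) =
         concat (map (map T) (map (map (@carrier C T)) Vss)).
  by rewrite e concat_map.
rewrite -(compA _ (tcast e)) (tens_map_fcast d e) actions_concat.
rewrite -!compA (compA (tens_alpha _)) tens_alpha_nat !compA.
rewrite -(compA g _ (tens_map (fam_map _ (actionss Vss)))) -tens_map_comp -H !tens_map_comp !compA -Hg.
rewrite -(compA _ _ (tens_map (fam_map _ F))) lax_iter_nat !fmap_comp.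
rewrite -!compA -lax_iter_cast (compA _ _ (tcast _)) lax_iter_alpha -!compA.
by rewrite tcast_comp (tcast_irr _ d).
Qed.

Lemma multilinear_comp Vss Ws Z (g : multilinear_map Ws Z)
    (fs : fam multilinear_map Vss Ws) :
  multilinear (sub_compose g fs).
Proof.
rewrite /sub_compose multilinear_cast.
exact: (multilinear_comp_tens _ (proj2_sig g) (multilinear_fam fs)).
Qed.

Definition multilinear_multicat : Multicategory :=
  @sub_multicat MC (Algebra T) (@carrier C T) multilinear multilinear_id
    multilinear_comp.

Lemma alg_hom_multilinear (V W : Algebra T) (f : hom V W) :
  f ∘ action V = action W ∘ fmap T f <-> @multilinear [V] W f.
Proof.
rewrite /multilinear -[lax_iter _ _]/(idm _) comp_idr.
by split=> H; exact: (eq_sym H).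
Qed.

Definition algebras_multilinear : Functor (algebras T) (underlying multilinear_multicat).
Proof.
refine (@Build_Functor (algebras T) (underlying multilinear_multicat) (fun V => V)
  (fun V W f => exist _ (proj1_sig f) (proj1 (alg_hom_multilinear _) (proj2_sig f)))
  _ _).
- by move=> V; apply: sub_mhom_eq.
- move=> V W X g f; apply: sub_mhom_eq => /=.
  rewrite /sub_compose hcast_refl /= /star_compose /=.
  have := tens_counit_l [carrier V]; rewrite comp_idl tcast_refl => E.
  by rewrite E comp_idr.
Defined.

Lemma algebras_multilinear_iso : is_iso_functor algebras_multilinear.
Proof.
have H (V W : Algebra T) (f : multilinear_map [V] W) :
    proj1_sig f ∘ action V = action W ∘ fmap T (proj1_sig f).
  exact: (proj2 (alg_hom_multilinear _) (proj2_sig f)).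
have Hid (V : Algebra T) : exist _ _ (H V V (sub_mid multilinear_id V)) = alg_id V.
  exact: alg_hom_eq.
have Hcomp (V W X : underlying multilinear_multicat) (g : hom W X) (f : hom V W) :
    exist _ _ (H V X (g ∘ f)) = alg_comp (exist _ _ (H W X g)) (exist _ _ (H V W f)).
  apply: alg_hom_eq; rewrite /= /sub_compose hcast_refl /= /star_compose /=.
  have := tens_counit_l [carrier V]; rewrite comp_idl tcast_refl => E.
  by rewrite E comp_idr.
exists (@Build_Functor (underlying multilinear_multicat) (algebras T)
  (fun V => V) (fun V W f => exist _ _ (H V W f)) Hid Hcomp).
by split; apply: functor_eq => V W f; [exact: alg_hom_eq | exact: sub_mhom_eq].
Qed.

End Multilinear.

(** * Reflexive coequalizers *)

Section Coequalizers.
Variable C : Category.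

Definition reflexive_pair (X Y : C) (f g : hom X Y) :=
  exists s : hom Y X, f ∘ s = idm Y /\ g ∘ s = idm Y.

Definition is_coequalizer (X Y Q : C) (f g : hom X Y) (q : hom Y Q) :=
  q ∘ f = q ∘ g /\
  forall (Z : C) (h : hom Y Z), h ∘ f = h ∘ g ->
    exists! k : hom Q Z, k ∘ q = h.

Definition has_reflexive_coequalizers :=
  forall (X Y : C) (f g : hom X Y), reflexive_pair f g ->
    exists (Q : C) (q : hom Y Q), is_coequalizer f g q.

Definition preserves_reflexive_coequalizers (F : Functor C C) :=
  forall (X Y Q : C) (f g : hom X Y) (q : hom Y Q), reflexive_pair f g ->
    is_coequalizer f g q -> is_coequalizer (fmap F f) (fmap F g) (fmap F q).

End Coequalizers.

(* Main.v *)
(** For algebras [V1, .., Vn] the reflexive pair [T (T V1 ⊗ .. ⊗ T Vn) ⇉ T (V1 ⊗ .. ⊗ Vn)]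
   given by [μ ∘ T φ] and [T (v1 ⊗ .. ⊗ vn)] has a coequalizer [q], which is again an
   algebra because [T] preserves it. The map [γ = q ∘ η] is the universal multilinear map
   out of [V1 ⊗ .. ⊗ Vn]: algebra maps [Q → W] correspond to multilinear maps
   [V1 ⊗ .. ⊗ Vn → W]. Choosing such a [Q] for every list, the maps [ε] and [α] are
   induced by the multilinear maps [id] and [γ ∘ (γ ⊗ .. ⊗ γ)], and the axioms hold
   because algebra maps out of [Q] agree as soon as they agree on [γ]. Since [⊗] need
   not preserve these coequalizers, [γ ∘ (γ ⊗ .. ⊗ γ)] need not be universal, so [α]
   is only a comparison map. *)

Require Import Defs.
From Stdlib Require Import List ProofIrrelevance FunctionalExtensionality.
From Stdlib Require Import IndefiniteDescription Program.Equality ssreflect.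
Import ListNotations.

Set Implicit Arguments.
Unset Strict Implicit.
Unset Printing Implicit Defensive.
Local Open Scope cat_scope.

(** * Reflexive coequalizers: cancellation and images under functors *)

Lemma coequalizer_epi (C : Category) (X Y Q : C) (f g : hom X Y) (q : hom Y Q) :
  is_coequalizer f g q ->
  forall (Z : C) (h k : hom Q Z), h ∘ q = k ∘ q -> h = k.
Proof.
case=> E U Z h k H.
have [|l [_ Ul]] := U Z (h ∘ q); first by rewrite -!compA E.
by rewrite -(Ul h) // -(Ul k).
Qed.

Lemma reflexive_pair_fmap (C D : Category) (F : Functor C D) (X Y : C)
    (f g : hom X Y) :
  reflexive_pair f g -> reflexive_pair (fmap F f) (fmap F g).
Proof.
by case=> s [fs gs]; exists (fmap F s); rewrite -!fmap_comp fs gs fmap_id.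
Qed.

(** * Construction of the universal multilinear map *)

Section RepresentingAlgebra.
Variables (C : MonoidalCategory) (T : MonoidalMonad C).

Definition universal_multilinear (Vs : list (Algebra T)) (Q : Algebra T)
    (q : hom (tens (map (@carrier C T) Vs)) Q) : Prop :=
  multilinear q /\
  forall (W : Algebra T) (f : hom (tens (map (@carrier C T) Vs)) W),
    multilinear f -> exists! k : alg_hom Q W, proj1_sig k ∘ q = f.

(** Iterates [eta_unit] and [eta_tensor] along the list. The cast appears because the tabulated
    family has source [map (fun X => X) Xs], equal to [Xs] only propositionally. *)
Lemma lax_iter_eta (Xs : list C) :
  lax_iter (mlax T) Xs ∘ tens_map (fam_tab (R := hom) (g := T) (eta T) Xs) ∘
    tcast (eq_sym (map_id Xs)) = eta T (tens Xs).
Proof.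
move: (eq_sym _); elim: Xs => [|X Xs IH] e /=.
  by rewrite tcast_refl comp_idr -[tens_map _]/(idm _) comp_idr; exact: eta_unit.
have e' : Xs = map (fun X => X) Xs by rewrite map_id.
apply: (inverse_mono (fmap_inverse T (tconsK _ _))).
rewrite !compA lax_iter_consr (re2 (tens_map_consr _ _)) !compA.
rewrite -(compA _ (tcons _ _)) (tcons_cast _ e') !compA.
rewrite -(compA _ (idm _ ⊠ _) (eta _ _ ⊠ _)) -tensor_map_comp.
rewrite -(compA _ _ (_ ⊠ tcast _)) -tensor_map_comp (IH e') comp_idl comp_idr.
by rewrite eta_tensor eta_nat.
Qed.

Lemma actions_eta (Vs : list (Algebra T)) :
  let Xs := map (@carrier C T) Vs in
  tens_map (actions Vs) ∘ tens_map (fam_tab (R := hom) (g := T) (eta T) Xs)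
    ∘ tcast (eq_sym (map_id Xs)) = idm (tens Xs).
Proof.
move=> /=; move: (eq_sym _); elim: Vs => [|V Vs IH] e.
  by rewrite tcast_refl !comp_idl.
have e' : map (@carrier C T) Vs = map (fun X => X) (map (@carrier C T) Vs).
  by rewrite map_id.
apply: (inverse_mono (tconsK _ _)).
rewrite /actions /= !compA tens_map_consr (re2 (tens_map_consr _ _)) !compA.
rewrite -(compA _ (tcons _ _)) (tcons_cast _ e') !compA -!tensor_map_comp.
by rewrite (IH e') comp_idr action_eta tensor_map_id comp_idl comp_idr.
Qed.

Section Coequalizer.
Variables (Vs : list (Algebra T)).
Let X := tens (map (@carrier C T) Vs).

Definition lax_free : hom (T (tens (map T (map (@carrier C T) Vs)))) (T X) :=
  mu T X ∘ fmap T (lax_iter (mlax T) (map (@carrier C T) Vs)).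

Definition action_free : hom (T (tens (map T (map (@carrier C T) Vs)))) (T X) :=
  fmap T (tens_map (actions Vs)).

(** The common section is [T] of the tensor product of the units: one composite reduces to
    [mu ∘ fmap T eta], the other to the unit laws of the algebras. *)
Lemma free_reflexive : reflexive_pair lax_free action_free.
Proof.
exists (fmap T (tens_map (fam_tab (R := hom) (g := T) (eta T) (map (@carrier C T) Vs)) ∘
        tcast (eq_sym (map_id (map (@carrier C T) Vs))))).
rewrite /lax_free /action_free -compA -!fmap_comp !compA actions_eta fmap_id.
by rewrite lax_iter_eta mu_fmap_eta.
Qed.

(** [action W ∘ fmap T f] is the extension of [f] to an algebra map out of the free algebra on [X];
    multilinearity of [f] is what makes it coequalize the pair. *)
Lemma free_map_coequalizes (W : Algebra T) (f : hom X W) :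
  multilinear f ->
  action W ∘ fmap T f ∘ lax_free = action W ∘ fmap T f ∘ action_free.
Proof.
move=> Hf; rewrite /lax_free /action_free compA -(compA (action W)) -mu_nat compA.
by rewrite action_mu -!compA -!fmap_comp compA Hf.
Qed.

Hypothesis hT : preserves_reflexive_coequalizers T.
Variables (Q : C) (q : hom (T X) Q).
Hypothesis hq : is_coequalizer lax_free action_free q.

(** Since [fmap T q] is again a coequalizer, [q ∘ mu] descends along it: both maps of the pair
    commute with [mu], being maps of free algebras. *)
Lemma coequalizer_action : exists a : hom (T Q) Q, a ∘ fmap T q = q ∘ mu T X.
Proof.
have [_ U] := hT free_reflexive hq.
have [|a [Ha _]] := U Q (q ∘ mu T X); last by exists a.
rewrite /lax_free /action_free -!compA mu_nat fmap_comp (compA (mu T X)) -mu_mu.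
rewrite -(compA (mu T X)) mu_nat !compA -(compA q (mu T X)).
by case: hq => ->.
Qed.

Lemma fmap_coequalizer_epi Z (h k : hom (T Q) Z) :
  h ∘ fmap T q = k ∘ fmap T q -> h = k.
Proof. exact: (coequalizer_epi (hT free_reflexive hq)). Qed.

Lemma coequalizer_algebra :
  exists V : Algebra T, exists r : hom (T X) V,
    is_coequalizer lax_free action_free r /\ action V ∘ fmap T r = r ∘ mu T X.
Proof.
have [a Ha] := coequalizer_action.
have a_eta : a ∘ eta T Q = idm Q.
  apply: (coequalizer_epi hq).
  by rewrite -compA eta_nat compA Ha -compA mu_eta comp_idr comp_idl.
have a_mu : a ∘ mu T Q = a ∘ fmap T a.
  (* An equation of maps out of [T (T Q)], so preservation is used twice, to cancel
     [fmap T (fmap T q)]. *)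
  apply: (coequalizer_epi (hT (reflexive_pair_fmap T free_reflexive)
                              (hT free_reflexive hq))).
  rewrite -!compA mu_nat -fmap_comp Ha fmap_comp !compA Ha -!compA.
  by rewrite mu_mu.
by exists (Build_Algebra a_eta a_mu), q.
Qed.

End Coequalizer.

Lemma universal_multilinear_exists (hC : has_reflexive_coequalizers C)
    (hT : preserves_reflexive_coequalizers T) (Vs : list (Algebra T)) :
  exists Q : Algebra T, exists q, @universal_multilinear Vs Q q.
Proof.
have [Q0 [q0 h0]] := hC _ _ _ _ (free_reflexive Vs).
have [Q [q [hq Hq]]] := coequalizer_algebra hT h0.
exists Q, (q ∘ eta T _); split.
  rewrite /multilinear fmap_comp compA Hq -(compA q) mu_fmap_eta comp_idr.
  rewrite -compA eta_nat compA.
  case: (hq) => <- _.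
  by rewrite /lax_free -!compA -eta_nat (compA (mu T _)) mu_eta comp_idl.
move=> W f Hf; case: (hq) => _ U.
have [k [Hk _]] := U _ _ (free_map_coequalizes Hf).
(* The coequalizer yields [k] only in [C]; compatibility with the actions is tested after the
   epimorphism [fmap T q]. *)
have Hk' : k ∘ action Q = action W ∘ fmap T k.
  apply: (fmap_coequalizer_epi hT hq).
  rewrite -!compA Hq compA Hk -fmap_comp Hk fmap_comp -compA -mu_nat !compA.
  by rewrite action_mu.
exists (exist _ k Hk'); split=> /=.
  by rewrite compA Hk -compA -eta_nat compA action_eta comp_idl.
(* An algebra map [l] satisfies [l ∘ q = action W ∘ fmap T (l ∘ q ∘ eta)], so its restriction along
   [q ∘ eta] determines it. *)
case=> l Hl /= El; apply: alg_hom_eq => /=; apply: (coequalizer_epi hq).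
rewrite Hk -El !fmap_comp !compA -Hl -(compA l) Hq -!compA.
by rewrite mu_fmap_eta comp_idr.
Qed.

End RepresentingAlgebra.

(** * Casts, families and equality of multifunctors *)

Lemma tens_alpha_cast (C : MonoidalCategory) (Xss Yss : list (list C)) (e : Xss = Yss)
    e1 e2 :
  tens_alpha Yss ∘ tcast (Xs := concat Xss) (Ys := concat Yss) e1 =
  tcast (Xs := map (@tens C) Xss) e2 ∘ tens_alpha Xss.
Proof. by subst; rewrite !tcast_refl comp_idl comp_idr. Qed.

(** Turns the transport that [fcast_cons] puts on a head entry into composition with a cast. *)
Lemma eq_rect_tens (C : MonoidalCategory) (Xs Ys : list C) (e : Ys = Xs) Z
    (f : hom (tens Xs) Z) :
  eq_rect _ (fun X : C => hom X Z) f _ (f_equal (@tens C) (eq_sym e)) = f ∘ tcast e.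
Proof. by subst; rewrite tcast_refl comp_idr. Qed.

(** Unlike [fam_map], this keeps the index lists, so a bijection of multimaps fixing the objects
    introduces no [map (fun X => X)]. *)
Fixpoint fam_trans A B (R R' : A -> B -> Type) (t : forall a b, R a b -> R' a b)
    l m (fs : fam R l m) : fam R' l m :=
  match fs with
  | fnil => fnil
  | fcons r fs => fcons (t _ _ r) (fam_trans t fs)
  end.

(** A multifunctor that fixes objects still has [map (fun X => X)] in its types; here the entrywise
    casts are gathered into a single one. *)
Lemma fam_map_trans (O : Type) (H H' : list O -> O -> Type)
    (t : forall Xs Y, H Xs Y -> H' Xs Y) Xss Ys (fs : fam H Xss Ys) e :
  fam_map (f := map (fun X : O => X)) (g := fun X => X) (R' := H')
     (fun Xs Y f => hcast (eq_sym (map_id Xs)) (t Xs Y f)) fs =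
  fcast e (eq_sym (map_id Ys)) (fam_trans t fs).
Proof.
elim: fs e => [|Xs Y l m f fs IH] e /=; first by rewrite fcast_nil.
have el : l = map (map (fun X => X)) l by case: e.
rewrite (fcast_cons (eq_sym (map_id Xs)) (eq_refl Y) el (eq_sym (map_id m))).
by rewrite -IH.
Qed.

Lemma map_map_id (O : Type) (Xss : list (list O)) :
  Xss = map (map (fun X => X)) Xss.
Proof. by rewrite -[LHS]map_id; apply: map_ext => Xs; rewrite map_id. Qed.

Lemma multifunctor_eq (M N : Multicategory) (o : M -> N)
    (m m' : forall Xs Y, mhom Xs Y -> mhom (map o Xs) (o Y)) h1 h2 h1' h2' :
  (forall Xs Y f, m Xs Y f = m' Xs Y f) ->
  @Build_Multifunctor M N o m h1 h2 = @Build_Multifunctor M N o m' h1' h2'.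
Proof.
move=> E; have Em : m = m'.
  apply: functional_extensionality_dep => Xs.
  apply: functional_extensionality_dep => Y.
  exact: functional_extensionality_dep (E Xs Y).
by subst; f_equal; exact: proof_irrelevance.
Qed.

(** * Algebra maps out of a chosen universal multilinear map *)

Section Colax.
Variables (C : MonoidalCategory) (T : MonoidalMonad C).
Variable star : list (Algebra T) -> Algebra T.
Variable gam : forall Vs, hom (tens (map (@carrier C T) Vs)) (star Vs).
Hypothesis gam_univ : forall Vs, universal_multilinear (gam Vs).
Local Notation D := (algebras T).
Local Notation c := (@carrier C T).

Lemma gam_multilinear Vs : multilinear (gam Vs).
Proof. exact: (proj1 (gam_univ Vs)). Qed.

Lemma lift_exists Vs W (f : multilinear_map Vs W) :
  exists k : alg_hom (star Vs) W, proj1_sig k ∘ gam Vs = proj1_sig f.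
Proof.
by have [k [Hk _]] := proj2 (gam_univ Vs) W _ (proj2_sig f); exists k.
Qed.

(** Universality gives existence as a proposition, whereas structure maps are data, hence the choice
    operator; [gam_inj] makes the choice immaterial. *)
Definition lift Vs W (f : multilinear_map Vs W) : alg_hom (star Vs) W :=
  proj1_sig (constructive_indefinite_description _ (lift_exists f)).

Lemma lift_gam Vs W (f : multilinear_map Vs W) :
  proj1_sig (lift f) ∘ gam Vs = proj1_sig f.
Proof. exact: (proj2_sig (constructive_indefinite_description _ (lift_exists f))). Qed.

Lemma alg_hom_gam_multilinear Vs W (g : alg_hom (star Vs) W) :
  multilinear (proj1_sig g ∘ gam Vs).
Proof.
rewrite /multilinear fmap_comp compA -(proj2_sig g) -!compA; congr (_ ∘ _).
by rewrite compA; exact: (gam_multilinear Vs).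
Qed.

(** The uniqueness half of universality. It reduces equations between algebra maps out of [star Vs]
    to equations in [C] between maps out of iterated tensor products. *)
Lemma gam_inj Vs W (f g : alg_hom (star Vs) W) :
  proj1_sig f ∘ gam Vs = proj1_sig g ∘ gam Vs -> f = g.
Proof.
move=> E; have [k [_ Uk]] := proj2 (gam_univ Vs) W _ (alg_hom_gam_multilinear g).
by rewrite -(Uk f) // -(Uk g).
Qed.

Lemma proj1_comp (V W X : D) (g : hom W X) (f : hom V W) :
  proj1_sig (g ∘ f) = proj1_sig g ∘ proj1_sig f.
Proof. by []. Qed.

(** * The structure maps and their composites with [gam] *)

Definition carrier_fam Vs Ws (fs : @fam D D hom Vs Ws) : fam hom (map c Vs) (map c Ws) :=
  fam_map (R := @hom D) (R' := hom) (f := c) (g := c) (fun V W f => proj1_sig f) fs.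

Lemma carrier_fam_id Vs : carrier_fam (fam_id (D := D) Vs) = fam_id (map c Vs).
Proof.
elim: Vs => //= V Vs IH.
by rewrite /carrier_fam /= -[fam_map _ _]/(carrier_fam _) IH.
Qed.

Lemma carrier_fam_comp Vs Ws Xs (gs : @fam D D hom Ws Xs) (fs : @fam D D hom Vs Ws) :
  carrier_fam (fam_comp (D := D) gs fs) = fam_comp (carrier_fam gs) (carrier_fam fs).
Proof.
elim: fs Xs gs => [|V W {}Vs {}Ws f fs IH] Xs gs; dependent destruction gs => //.
by rewrite /carrier_fam /fam_comp /= -/(fam_comp _ _) -/(carrier_fam _) IH.
Qed.

Lemma actions_nat Vs Ws (fs : @fam D D hom Vs Ws) :
  fam_comp (actions Ws) (fam_map (@fmap _ _ T) (carrier_fam fs)) =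
  fam_comp (carrier_fam fs) (actions Vs).
Proof.
elim: fs => //= V W {}Vs {}Ws f fs IH.
rewrite /fam_comp /=; f_equal; last exact: IH.
by rewrite (proj2_sig f).
Qed.

Lemma gam_map_multilinear Vs Ws (fs : @fam D D hom Vs Ws) :
  multilinear (gam Ws ∘ tens_map (carrier_fam fs)).
Proof.
rewrite /multilinear fmap_comp -!compA -lax_iter_nat !compA gam_multilinear -!compA.
by rewrite -!tens_map_comp actions_nat.
Qed.

Definition alg_star_map Vs Ws (fs : @fam D D hom Vs Ws) : @hom D (star Vs) (star Ws) :=
  lift (exist _ _ (gam_map_multilinear fs)).

Lemma alg_star_map_gam Vs Ws (fs : @fam D D hom Vs Ws) :
  proj1_sig (alg_star_map fs) ∘ gam Vs = gam Ws ∘ tens_map (carrier_fam fs).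
Proof. exact: lift_gam. Qed.

Definition alg_eps (V : Algebra T) : @hom D (star [V]) V :=
  lift (Vs := [V]) (exist _ _ (multilinear_id V)).

Lemma alg_eps_gam V : proj1_sig (alg_eps V) ∘ gam [V] = idm (carrier V).
Proof. exact: lift_gam. Qed.

(** The entries are the maps [gam] themselves; [fam_map] only rewrites the index lists. Its image
    under [tens_map] is γ ⊗ .. ⊗ γ. *)
Definition gams (Vss : list (list (Algebra T))) :
    fam hom (map (@tens C) (map (map c) Vss)) (map c (map star Vss)) :=
  fam_map (f := @tens C) (g := c) (fun _ _ f => f)
    (fam_tab (R := fun Xs (V : Algebra T) => hom (tens Xs) (carrier V))
       (f := map c) (g := star) gam Vss).

(** Multilinearity of [gam] in each block, in the form that [multilinear_comp_tens] requires to
    produce the multilinear map inducing α. *)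
Lemma gams_multilinear (Vss : list (list (Algebra T))) :
  fam_comp (fam_comp (actions (map star Vss)) (fam_map (@fmap _ _ T) (gams Vss)))
   (fam_map (f := @tens C) (g := T) (fun _ _ f => f)
      (fam_tab (R := fun Xs V => hom (tens Xs) (T V)) (f := map T) (g := @tens C)
         (lax_iter (mlax T)) (map (map c) Vss))) =
  fam_comp (gams Vss) (fam_map (@tens_map C) (actionss Vss)).
Proof.
elim: Vss => [|Vs Vss IH] //; rewrite /fam_comp /=.
f_equal; [exact: (gam_multilinear Vs) | exact: IH].
Qed.

Definition alg_alpha (Vss : list (list (Algebra T))) :
    @hom D (star (concat Vss)) (star (map star Vss)) :=
  lift (exist _ _ (multilinear_comp_tens (concat_map c Vss)
                     (@gam_multilinear (map star Vss)) (gams_multilinear Vss))).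

Lemma alg_alpha_gam Vss :
  proj1_sig (alg_alpha Vss) ∘ gam (concat Vss) =
  gam (map star Vss) ∘ tens_map (gams Vss) ∘ tens_alpha (map (map c) Vss)
    ∘ tcast (concat_map c Vss).
Proof. exact: lift_gam. Qed.

(** An equality of lists casts both algebras and tensor products; [gam] intertwines the two casts,
    whatever the equality proofs. *)
Lemma idto_gam Vs Ws (e : Vs = Ws) e1 e2 :
  proj1_sig (idto (C := D) (X := star Vs) (Y := star Ws) e1) ∘ gam Vs =
  gam Ws ∘ tcast (Xs := map c Vs) (Ys := map c Ws) e2.
Proof. by subst; rewrite idto_refl tcast_refl comp_idl comp_idr. Qed.

(** * Functoriality and naturality *)

Lemma alg_star_id Vs : alg_star_map (fam_id (D := D) Vs) = idm (star Vs : D).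
Proof.
apply: gam_inj; rewrite alg_star_map_gam carrier_fam_id tens_map_id.
by rewrite comp_idr /= comp_idl.
Qed.

Lemma alg_star_comp Vs Ws Xs (gs : @fam D D hom Ws Xs) (fs : @fam D D hom Vs Ws) :
  alg_star_map (fam_comp (D := D) gs fs) = comp (c := D) (alg_star_map gs) (alg_star_map fs).
Proof.
apply: gam_inj; rewrite alg_star_map_gam carrier_fam_comp tens_map_comp.
by rewrite proj1_comp -compA alg_star_map_gam !compA alg_star_map_gam.
Qed.

Lemma alg_eps_nat (V W : D) (f : hom V W) :
  comp (c := D) (alg_eps W) (alg_star_map (fcons (R := @hom D) f fnil)) = f ∘ alg_eps V.
Proof.
apply: gam_inj; rewrite !proj1_comp -!compA alg_eps_gam alg_star_map_gam compA alg_eps_gam.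
by rewrite comp_idl comp_idr.
Qed.

Definition carrier_famss Vss Wss (fss : @fam _ _ (fam (@hom D)) Vss Wss) :
    fam (fam hom) (map (map c) Vss) (map (map c) Wss) :=
  fam_map (f := map c) (g := map c) carrier_fam fss.

Lemma gams_nat Vss Wss (fss : @fam _ _ (fam (@hom D)) Vss Wss) :
  fam_comp (carrier_fam (fam_map (f := star) (g := star) (R' := @hom D) alg_star_map fss))
    (gams Vss) =
  fam_comp (gams Wss) (fam_map (@tens_map C) (carrier_famss fss)).
Proof.
elim: fss => [|Vs Ws {}Vss {}Wss fs fss IH] //; rewrite /fam_comp /=.
f_equal; [exact: alg_star_map_gam | exact: IH].
Qed.

(** After composition with [gam], [gams_nat] slides the maps past the blockwise γ, and naturality of
    [tens_alpha] remains. *)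
Lemma alg_alpha_nat Vss Wss (fss : @fam _ _ (fam (@hom D)) Vss Wss) :
  comp (c := D) (alg_alpha Wss) (alg_star_map (fam_concat fss)) =
  comp (c := D)
    (alg_star_map (fam_map (f := star) (g := star) (R' := @hom D) alg_star_map fss))
    (alg_alpha Vss).
Proof.
apply: gam_inj; rewrite !proj1_comp -!compA alg_star_map_gam alg_alpha_gam !compA.
rewrite alg_alpha_gam alg_star_map_gam -(compA _ _ (tens_map (gams Vss))).
rewrite -tens_map_comp gams_nat tens_map_comp -(compA _ (tcast _)).
rewrite (tens_map_fcast (concat_map c Vss) (concat_map c Wss)).
have -> : fcast (concat_map c Vss) (concat_map c Wss) (carrier_fam (fam_concat fss)) =
          fam_concat (carrier_famss fss).
  rewrite /carrier_fam (fam_map_concat _ _ (eq_sym (concat_map c Vss))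
                          (eq_sym (concat_map c Wss))) fcast_comp.
  exact: fcast_refl.
rewrite !compA -(compA _ _ (tens_map (fam_concat _))) tens_alpha_nat.
by rewrite !compA.
Qed.

(** * Coassociativity *)

Fixpoint gamss (Vsss : list (list (list (Algebra T)))) :
    fam (fam hom) (map (map (@tens C)) (map (map (map c)) Vsss))
      (map (map c) (map (map star) Vsss)) :=
  match Vsss with
  | [] => fnil
  | Vss :: Vsss => fcons (gams Vss) (gamss Vsss)
  end.

Lemma gams_app Vss Wss e e' :
  gams (Vss ++ Wss) = fcast e e' (fam_app (gams Vss) (gams Wss)).
Proof.
elim: Vss e e' => [|Vs Vss IH] e e' /=; first by rewrite fcast_refl.
rewrite /gams /= -!/(gams _).
have el : map (@tens C) (map (map c) Vss) ++ map (@tens C) (map (map c) Wss) =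
          map (@tens C) (map (map c) (Vss ++ Wss)) by case: e.
have em : map c (map star Vss) ++ map c (map star Wss) =
          map c (map star (Vss ++ Wss)) by case: e'.
by rewrite (fcast_cons eq_refl eq_refl el em) -IH.
Qed.

Lemma gams_concat Vsss e e' : fcast e e' (gams (concat Vsss)) = fam_concat (gamss Vsss).
Proof.
elim: Vsss e e' => [|Vss Vsss IH] e e' /=; first by rewrite fcast_refl.
have a : map (@tens C) (map (map c) Vss) ++ map (@tens C) (map (map c) (concat Vsss)) =
  map (@tens C) (map (map c) (Vss ++ concat Vsss)) by rewrite !map_app.
have b : map c (map star Vss) ++ map c (map star (concat Vsss)) =
  map c (map star (Vss ++ concat Vsss)) by rewrite !map_app.
have d : map (@tens C) (map (map c) (concat Vsss)) =
         concat (map (map (@tens C)) (map (map (map c)) Vsss)).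
  by rewrite !concat_map.
have d' : map c (map star (concat Vsss)) = concat (map (map c) (map (map star) Vsss)).
  by rewrite !concat_map.
rewrite (gams_app a b) fcast_comp -(IH d d').
have e1 : map (@tens C) (map (map c) Vss) ++ map (@tens C) (map (map c) (concat Vsss)) =
  map (@tens C) (map (map c) Vss) ++ concat (map (map (@tens C)) (map (map (map c)) Vsss)).
  by rewrite d.
have e2 : map c (map star Vss) ++ map c (map star (concat Vsss)) =
  map c (map star Vss) ++ concat (map (map c) (map (map star) Vsss)) by rewrite d'.
rewrite (fam_app_fcast _ _ _ _ e1 e2); exact: fcast_irr.
Qed.

Definition alg_alphas (Vsss : list (list (list (Algebra T)))) :
    @fam D D hom (map star (map (@concat _) Vsss)) (map star (map (map star) Vsss)) :=
  fam_map (f := star) (g := star) (fun _ _ f => f)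
    (fam_tab (R := fun Vs Ws => @hom D (star Vs) (star Ws))
       (f := @concat D) (g := map star) alg_alpha Vsss).

Definition tens_alphas (Xsss : list (list (list C))) :
    fam hom (map (@tens C) (map (@concat _) Xsss))
      (map (@tens C) (map (map (@tens C)) Xsss)) :=
  fam_map (f := @tens C) (g := @tens C) (fun _ _ f => f)
    (fam_tab (R := fun Xs Ys => hom (tens Xs) (tens Ys))
       (f := @concat C) (g := map (@tens C)) (@tens_alpha C) Xsss).

Lemma gams_alphas Vsss e :
  fam_comp (carrier_fam (alg_alphas Vsss)) (gams (map (@concat _) Vsss)) =
  fcast e eq_refl
    (fam_comp (fam_comp (gams (map (map star) Vsss))
                 (fam_map (@tens_map C) (gamss Vsss)))
       (tens_alphas (map (map (map c)) Vsss))).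
Proof.
elim: Vsss e => [|Vss Vsss IH] e; first by rewrite fcast_refl.
rewrite /fam_comp /=.
have el : map (@tens C) (map (@concat _) (map (map (map c)) Vsss)) =
          map (@tens C) (map (map c) (map (@concat _) Vsss)) by case: e.
rewrite (fcast_cons (f_equal (@tens C) (eq_sym (concat_map c Vss))) eq_refl el eq_refl).
rewrite -(IH el) /=; f_equal.
by rewrite alg_alpha_gam eq_rect_tens.
Qed.

Lemma tens_map_fcastl Xs Xs' Ys (e : Xs = Xs') (fs : @fam C C hom Xs Ys) :
  tens_map (fcast e eq_refl fs) = tens_map fs ∘ tcast (eq_sym e).
Proof. by subst; rewrite tcast_refl comp_idr. Qed.

(** After composition with [gam], each side consists of three layers of γ and two rebracketings, so
    [tens_coassoc] identifies them. *)
Lemma alg_coassoc (Vsss : list (list (list D))) :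
  comp (c := D) (comp (c := D) (alg_alpha (map (map star) Vsss))
      (idto (C := D) (f_equal star (concat_map star Vsss)))) (alg_alpha (concat Vsss)) =
  comp (c := D) (comp (c := D) (alg_star_map (alg_alphas Vsss))
     (alg_alpha (map (@concat D) Vsss))) (idto (C := D) (f_equal star (concat_concat Vsss))).
Proof.
apply: gam_inj; rewrite !proj1_comp; set A := map (map (map c)) Vsss.
have e1 : map c (map star (concat Vsss)) = map c (concat (map (map star) Vsss)).
  by congr (map _ _); exact: concat_map.
have e2 : map c (concat (concat Vsss)) = map c (concat (map (@concat _) Vsss)).
  by congr (map _ _); exact: concat_concat.
rewrite -!compA alg_alpha_gam (idto_gam (concat_concat Vsss) _ e2).
rewrite !compA -(compA _ (proj1_sig _) (gam _)) (idto_gam (concat_map star Vsss) _ e1).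
rewrite !compA alg_alpha_gam -(compA _ (proj1_sig _) (gam _)) alg_alpha_gam !compA.
rewrite alg_star_map_gam -!(compA _ (tcast _) (tcast _)) !tcast_comp.
rewrite -(compA _ _ (tens_map (gams (map _ Vsss)))) -tens_map_comp.
have e7 : map (@concat _) A = map (map c) (map (@concat _) Vsss).
  by rewrite /A !map_map; apply: map_ext => Vss; rewrite concat_map.
have e3 : map (@tens C) (map (@concat _) A) =
          map (@tens C) (map (map c) (map (@concat _) Vsss)).
  by rewrite e7.
rewrite (gams_alphas e3) tens_map_fcastl !tens_map_comp.
have d : map (@tens C) (map (map c) (concat Vsss)) = concat (map (map (@tens C)) A).
  by rewrite /A !concat_map.
(* Written as a concatenation, the innermost layer of γ passes through [tens_alpha] by
   naturality. *)
rewrite -(compA _ (tcast _) (tens_map (gams _))) (tens_map_fcast d) gams_concat.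
rewrite !compA -(compA _ _ (tens_map (fam_concat _))) tens_alpha_nat !compA.
have e4 : concat A = map (map c) (concat Vsss) by rewrite /A concat_map.
have e5 : concat (map (map c) (concat Vsss)) = concat (concat A) by rewrite e4.
have e6 : map (@tens C) (map (map c) (concat Vsss)) = map (@tens C) (concat A).
  by rewrite e4.
have -> : tcast d = tcast (concat_map (@tens C) A) ∘ tcast e6.
  by rewrite tcast_comp; exact: tcast_irr.
rewrite !compA -(compA _ (tcast e6)) -(tens_alpha_cast (eq_sym e4) e5 e6) !compA.
rewrite (re3 (tens_coassoc A)) !compA -/(tens_alphas A).
have e8 : concat (map (map c) (map (@concat _) Vsss)) = concat (map (@concat _) A).
  by rewrite e7.
rewrite -(compA _ (tcast (eq_sym e3))) -(tens_alpha_cast (eq_sym e7) e8) !compA.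
rewrite -!(compA _ (tcast _)) !tcast_comp; congr (_ ∘ _); exact: tcast_irr.
Qed.

(** * Counitality *)

Lemma alg_counit_l (Vs : list D) :
  comp (c := D) (alg_eps (star Vs)) (alg_alpha [Vs]) =
  idto (C := D) (f_equal star (app_nil_r Vs)).
Proof.
have e : map c (Vs ++ []) = map c Vs by rewrite app_nil_r.
have H := tens_counit_l (map c Vs); rewrite comp_idl in H.
apply: gam_inj; rewrite (idto_gam (app_nil_r Vs) _ e) proj1_comp -compA alg_alpha_gam.
rewrite [tens_alpha _]H !compA alg_eps_gam comp_idl -[tens_map _]/(gam Vs).
rewrite -compA (tcast_comp (concat_map c [Vs]) (app_nil_r (map c Vs))).
exact: (f_equal (comp (gam Vs)) (tcast_irr _ e)).
Qed.

Definition alg_epss (Vs : list D) : @fam D D hom (map star (map (@sing D) Vs)) Vs :=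
  fam_mapl (f := star) (R := @hom D) (fam_mapl (f := @sing D) (fam_diag alg_eps Vs)).

(** Each entry is ε ∘ γ, an identity; this reduces the right counit law to [tens_counit_r]. *)
Lemma alg_epss_gams Vs e :
  fam_comp (carrier_fam (alg_epss Vs)) (gams (map (@sing _) Vs)) =
  fcast e eq_refl (fam_mapl (f := @tens C)
    (fam_mapl (f := @sing C) (fam_diag (fun X : C => idm X) (map c Vs)))).
Proof.
elim: Vs e => [|V Vs IH] e; first by rewrite fcast_refl.
rewrite /fam_comp /=.
have el : map (@tens C) (map (@sing C) (map c Vs)) =
          map (@tens C) (map (map c) (map (@sing _) Vs)) by case: e.
rewrite (fcast_cons eq_refl eq_refl el eq_refl) -(IH el) /=; f_equal.
exact: alg_eps_gam.
Qed.

Lemma alg_counit_r (Vs : list D) :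
  comp (c := D) (alg_star_map (alg_epss Vs)) (alg_alpha (map (@sing D) Vs)) =
  idto (C := D) (f_equal star (concat_sing Vs)).
Proof.
have e : map c (concat (map (@sing _) Vs)) = map c Vs by rewrite concat_sing.
have e7 : map (@sing C) (map c Vs) = map (map c) (map (@sing _) Vs).
  by rewrite !map_map.
have e1 : map (@tens C) (map (@sing C) (map c Vs)) =
          map (@tens C) (map (map c) (map (@sing _) Vs)) by rewrite e7.
have e8 : concat (map (map c) (map (@sing _) Vs)) = concat (map (@sing C) (map c Vs)).
  by rewrite e7.
apply: gam_inj; rewrite (idto_gam (concat_sing Vs) _ e) proj1_comp.
rewrite -compA alg_alpha_gam !compA alg_star_map_gam -(compA _ _ (tens_map (gams _))) -tens_map_comp.
rewrite (alg_epss_gams e1) tens_map_fcastl.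
rewrite !compA -(compA _ (tcast _)) -(tens_alpha_cast (eq_sym e7) e8) !compA.
rewrite -(compA (gam Vs)) tens_counit_r -!(compA _ (tcast _)) !tcast_comp.
congr (_ ∘ _); exact: tcast_irr.
Qed.

(** * The colax structure, its normality and the forgetful functor *)

Definition algebra_colax : ColaxMonoidal D :=
  @Build_ColaxMonoidal D star alg_star_map alg_star_id alg_star_comp alg_eps alg_eps_nat
    alg_alpha alg_alpha_nat alg_coassoc alg_counit_l alg_counit_r.

(** A multilinear map in one variable is an algebra map, so [gam [V]] is a morphism of algebras, and
    it is inverse to ε. *)
Lemma algebra_colax_normal : normal algebra_colax.
Proof.
move=> V.
have H : gam [V] ∘ action V = action (star [V]) ∘ fmap T (gam [V]).
  apply/alg_hom_multilinear; exact: (gam_multilinear [V]).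
exists (exist _ (gam [V]) H); split.
  apply: gam_inj; rewrite proj1_comp -compA alg_eps_gam comp_idl comp_idr //.
apply: alg_hom_eq; exact: alg_eps_gam.
Qed.

(** The axioms are the very equations that characterize [alg_star_map], [alg_alpha] and
    [alg_eps]. *)
Definition forgetful_monoidal :
  ColaxMonoidalFunctor algebra_colax (tens_colax C) (forgetful T).
Proof.
refine (@Build_ColaxMonoidalFunctor D C algebra_colax (tens_colax C) (forgetful T)
          gam _ _ alg_eps_gam).
- by move=> Vs Ws fs; rewrite -[RHS]/(_ ∘ _) [RHS]alg_star_map_gam.
- exact: alg_alpha_gam.
Defined.

(** * The isomorphism with the multicategory of multilinear maps *)

Local Notation M := (multicat_of_colax algebra_colax).
Local Notation N := (multilinear_multicat T).

Definition to_multilinear (Vs : list (Algebra T)) (W : Algebra T)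
    (f : alg_hom (star Vs) W) : multilinear_map Vs W :=
  exist _ _ (alg_hom_gam_multilinear f).

Lemma lift_to_multilinear Vs W (f : alg_hom (star Vs) W) : lift (to_multilinear f) = f.
Proof. by apply: gam_inj; rewrite lift_gam. Qed.

Lemma to_multilinear_lift Vs W (f : multilinear_map Vs W) : to_multilinear (lift f) = f.
Proof. by apply: sub_mhom_eq; exact: lift_gam. Qed.

Lemma to_multilinear_fam Vss Ws (fs : fam (star_hom algebra_colax) Vss Ws) :
  fam_comp (carrier_fam (fam_mapl (R := @hom D) (f := star) fs)) (gams Vss) =
  fam_mapl (R := hom) (f := @tens C)
    (sub_forget (M := multicat_of_colax (tens_colax C)) (fam_trans to_multilinear fs)).
Proof.
elim: fs => [|Vs W {}Vss {}Ws f fs IH] //; rewrite /fam_comp /=.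
f_equal; exact: IH.
Qed.

(** Composed with γ, α inserts a γ in every block, and these combine with [fs] into the associated
    multilinear maps. *)
Lemma to_multilinear_comp Vss Ws X (g : star_hom algebra_colax Ws X)
    (fs : fam (star_hom algebra_colax) Vss Ws) :
  to_multilinear (star_compose g fs) =
  mcomp (m := N) (to_multilinear g) (fam_trans to_multilinear fs).
Proof.
apply: sub_mhom_eq; rewrite /= /sub_compose multilinear_cast.
rewrite -[LHS]/(proj1_sig g ∘ proj1_sig (alg_star_map _) ∘ proj1_sig (alg_alpha Vss)
  ∘ gam (concat Vss)).
rewrite -!(compA _ _ (gam _)) alg_alpha_gam !compA.
rewrite -(compA _ _ (gam _)) alg_star_map_gam !compA.
rewrite -(compA _ _ (tens_map (gams _))) -tens_map_comp to_multilinear_fam.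
congr (_ ∘ _); exact: tcast_irr.
Qed.

(** Transported from [to_multilinear_comp] along the bijection between [lift] and
    [to_multilinear]. *)
Lemma lift_comp Vss Ws X (g : multilinear_map Ws X)
    (fs : fam (@multilinear_map C T) Vss Ws) :
  lift (mcomp (m := N) g fs) =
  mcomp (m := M) (lift g) (fam_trans lift fs).
Proof.
have E : fam_trans to_multilinear (fam_trans lift fs) = fs.
  by elim: fs {g} => //= Vs W {}Vss {}Ws f fs ->; rewrite to_multilinear_lift.
rewrite -[RHS]lift_to_multilinear; congr (lift _); symmetry.
by rewrite [LHS]to_multilinear_comp to_multilinear_lift E.
Qed.

Definition colax_to_multilinear : Multifunctor M N.
Proof.
refine (@Build_Multifunctor M N (fun V => V)
  (fun Vs W f => hcast (eq_sym (map_id Vs)) (to_multilinear f)) _ _).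
- move=> V; rewrite hcast_refl; apply: sub_mhom_eq; exact: alg_eps_gam.
- move=> Vss Ws X g fs.
  rewrite (fam_map_trans to_multilinear _ (map_map_id Vss)).
  rewrite (mcomp_fcast (M := N)) -(to_multilinear_comp g fs) [LHS]hcast_comp.
  exact: (hcast_irr (H := @multilinear_map C T)).
Defined.

Definition multilinear_to_colax : Multifunctor N M.
Proof.
refine (@Build_Multifunctor N M (fun V => V)
  (fun Vs W f => hcast (H := star_hom algebra_colax) (eq_sym (map_id Vs)) (lift f)) _ _).
- by move=> V; rewrite hcast_refl.
- move=> Vss Ws X g fs.
  rewrite (fam_map_trans (H' := star_hom algebra_colax) lift _ (map_map_id Vss)).
  rewrite (mcomp_fcast (M := M)) -(lift_comp g fs) [LHS]hcast_comp.
  exact: hcast_irr.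
Defined.

Lemma colax_to_multilinear_iso : is_iso_multifunctor colax_to_multilinear.
Proof.
exists multilinear_to_colax; split; apply: multifunctor_eq => Vs W f.
- rewrite [mfmap colax_to_multilinear f]/= mfmap_hcast /= hcast_comp lift_to_multilinear.
  rewrite hcast_comp; exact: hcast_irr.
- rewrite [mfmap multilinear_to_colax f]/= mfmap_hcast /= hcast_comp to_multilinear_lift.
  rewrite hcast_comp; exact: hcast_irr.
Qed.

(** The canonical functor sends [f] to [f ∘ ε], and composing with γ returns [f] because ε ∘ γ is
    the identity. *)
Lemma colax_to_multilinear_underlying :
  functor_comp (underlying_functor colax_to_multilinear)
    (canonical_functor algebra_colax) = algebras_multilinear T.
Proof.
apply: functor_eq => V W f; rewrite /= hcast_refl; apply: sub_mhom_eq.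
by rewrite /= -compA alg_eps_gam comp_idr.
Qed.

End Colax.

Theorem proposition3p9 (C : MonoidalCategory) (T : MonoidalMonad C)
    (hC : has_reflexive_coequalizers C)
    (hT : preserves_reflexive_coequalizers T) :
  exists S : ColaxMonoidal (algebras T),
    normal S /\
    (exists U : ColaxMonoidalFunctor S (tens_colax C) (forgetful T),
       forall Vs : list (Algebra T),
         multilinear (W := star S Vs) (gamma U Vs)) /\
    (exists Phi : Multifunctor (multicat_of_colax S) (multilinear_multicat T),
       is_iso_multifunctor Phi /\
       functor_comp (underlying_functor Phi) (canonical_functor S) =
       algebras_multilinear T).
Proof.
(* Two choices for every list: first the algebra, then its universal map. *)
pose Q Vs := constructive_indefinite_description _ (universal_multilinear_exists hC hT Vs).
pose q Vs := constructive_indefinite_description _ (proj2_sig (Q Vs)).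
have q_univ Vs : universal_multilinear (proj1_sig (q Vs)) := proj2_sig (q Vs).
exists (algebra_colax q_univ); split; first exact: algebra_colax_normal.
split; first by exists (forgetful_monoidal q_univ) => Vs; exact: (gam_multilinear q_univ).
exists (colax_to_multilinear q_univ); split.
- exact: colax_to_multilinear_iso.
- exact: colax_to_multilinear_underlying.
Qed.
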